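(* There exists a deterministic (non-oblivious local search) algorithm which, for every fixed $\varepsilon > 0$, given value oracle access to a non-negative monotone submodular function $f\colon 2^{\mathcal{N}} \to \mathbb{R}_{\geq 0}$ and independence oracle access to a matroid $\mathcal{M} = (\mathcal{N}, \mathcal{I})$ over the same ground set, outputs a set $S \in \mathcal{I}$ with $f(S) \geq (1 - 1/e - \varepsilon)\cdot \max\{f(T) : T \in \mathcal{I}\}$, using $\tilde{O}_\varepsilon(nr)$ value and independence oracle queries, where $n = |\mathcal{N}|$ and $r$ is the rank of $\mathcal{M}$. Using randomization, the query complexity can be improved to $\tilde{O}_\varepsilon(n + r\sqrt{n})$ (with the approximation guarantee $1 - 1/e - \varepsilon$ holding in expectation).
   Context: A set function $f\colon 2^{\mathcal{N}}\to\mathbb{R}$ is monotone if $f(S)\le f(T)$ whenever $S\subseteq T$, and submodular if $f(S)+f(T)\ge f(S\cap T)+f(S\cup T)$ for all $S,T\subseteq\mathcal{N}$. A matroid $\mathcal{M}=(\mathcal{N},\mathcal{I})$ is a non-empty down-closed family $\mathcal{I}$ of subsets of $\mathcal{N}$ (the independent sets) satisfying the exchange axiom; its rank is the maximum size of an independent set. A value oracle returns $f(S)$ given $S$; an independence oracle answers whether $S \in \mathcal{I}$. The query complexity counts oracle calls. The notation $\tilde{O}_\varepsilon(\cdot)$ suppresses poly-logarithmic factors and factors depending only on $\varepsilon$. *)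

(* Defs.v *)
From HB Require Import structures.
From mathcomp Require Import all_boot all_order all_algebra.
From mathcomp Require Import reals sequences exp.
Set Implicit Arguments.
Unset Strict Implicit.
Unset Printing Implicit Defensive.
Import Order.TTheory GRing.Theory Num.Theory.
Local Open Scope ring_scope.

Section SetFunctions.
Variables (R : realType) (N : finType).
Implicit Types (f : {set N} -> R) (I : {set {set N}}).

Definition nonnegative f := forall S : {set N}, 0 <= f S.

Definition monotone f := forall S T : {set N}, S \subset T -> f S <= f T.

Definition submodular f :=
  forall S T : {set N}, f (S :&: T) + f (S :|: T) <= f S + f T.

Definition matroid I :=
  [/\ I != set0,
      forall S T : {set N}, T \in I -> S \subset T -> S \in I
    & forall S T : {set N}, S \in I -> T \in I -> (#|S| < #|T|)%N ->
        exists2 x, x \in T :\: S & x |: S \in I].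

Definition matroid_rank I : nat := \max_(S in I) #|S|.

(* The default value 0 of the iterated maximum is harmless: it is only used
   for f nonnegative and I nonempty. *)
Definition opt f I : R := \big[Num.max/0]_(T in I) f T.

Definition instance f I :=
  [/\ nonnegative f, monotone f, submodular f & matroid I].

End SetFunctions.

(* A deterministic query algorithm on the ground set N is an adaptive strategy:
   it either stops with an output set or calls one of the two oracles on a set
   of its choice, and continues according to the answer. Only oracle calls are
   charged. The strategy depends on neither f nor the matroid (nor its rank)
   except through the oracle answers. *)
Inductive query_alg (R : Type) (N : finType) : Type :=
| Output (Q : {set N})
| AskValue (Q : {set N}) (next : R -> query_alg R N)
| AskIndep (Q : {set N}) (next : bool -> query_alg R N).

Section Run.
Variables (R : realType) (N : finType).
Variables (f : {set N} -> R) (I : {set {set N}}).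

Fixpoint output (A : query_alg R N) : {set N} :=
  match A with
  | Output Q => Q
  | AskValue Q next => output (next (f Q))
  | AskIndep Q next => output (next (Q \in I))
  end.

Fixpoint queries (A : query_alg R N) : nat :=
  match A with
  | Output _ => 0
  | AskValue Q next => (queries (next (f Q))).+1
  | AskIndep Q next => (queries (next (Q \in I))).+1
  end.

End Run.

(* A randomized query algorithm is a finitely supported probability
   distribution over deterministic ones. *)
Record rand_query_alg (R : realType) (N : finType) := RandQueryAlg {
  seed : finType;
  prob : seed -> R;
  prob_ge0 : forall w, 0 <= prob w;
  prob_sum1 : \sum_w prob w = 1;
  run_with :> seed -> query_alg R N }.

Definition expected_value (R : realType) (N : finType) (f : {set N} -> R)
    (I : {set {set N}}) (A : rand_query_alg R N) : R :=
  \sum_w prob w * f (output f I (A w)).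

(* The summand 1 keeps the factor nonzero at n = 1. *)
Definition polylog (R : realType) (k n : nat) : R := (1 + ln n%:R) ^+ k.

(* Main.v *)
Require Import Defs.
From mathcomp Require Import all_boot all_order all_algebra.
From mathcomp Require Import reals sequences exp.
From mathcomp Require Import zify ring lra.
Set Implicit Arguments.
Unset Strict Implicit.
Unset Printing Implicit Defensive.
Import Order.TTheory GRing.Theory Num.Theory.
Local Open Scope ring_scope.

(** Non-oblivious local search. Split the solution into [L ~ 1/eps] colour classes
    and maximize, over coloured bases, the potential [g S = sum_J w_|J| f(S_J)], where
    [S_J] is the union of the classes in [J]. The weights solve a recurrence which makes
    the local optimality conditions of [g], summed over an injective exchange with an
    optimal solution given all colours in turn, telescope to
    [f(S) >= (1 - (1 + 1/L)^-L) OPT] minus the total gain of the exchanges. The gain of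
    an exchange is bounded below by a difference of two quantities depending on one
    element each, so the best partner of an entering element is the lightest element of
    its fundamental circuit, found by binary search. The potential is [O_eps(OPT)] and a
    step gains a [1/r] fraction of the total gain, so among [O_eps(r)] iterates the best
    one has a small total gain. Examining all elements costs [O~(n)] per step. With
    randomization, a step examines only a random block of [b = min(r, sqrt n)] elements
    of the solution and [n/2b] random entering elements: each exchange pair is seen
    with probability about [1/2r], and the seen pairs rarely collide. *)

(** * Query programs *)

Section Programs.
Variables (R : realType) (N : finType).

Inductive prog (X : Type) : Type :=
| Ret (x : X)
| Value (Q : {set N}) (next : R -> prog X)
| Indep (Q : {set N}) (next : bool -> prog X).

Fixpoint bind X Y (p : prog X) (k : X -> prog Y) : prog Y :=
  match p with
  | Ret x => k x
  | Value Q next => Value Q (fun v => bind (next v) k)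
  | Indep Q next => Indep Q (fun v => bind (next v) k)
  end.

Fixpoint compile (p : prog {set N}) : query_alg R N :=
  match p with
  | Ret Q => Output R Q
  | Value Q next => AskValue Q (fun v => compile (next v))
  | Indep Q next => AskIndep Q (fun v => compile (next v))
  end.

Fixpoint mapM X Y (c : X -> prog Y) (s : seq X) : prog (seq Y) :=
  if s is x :: s' then bind (c x) (fun y => bind (mapM c s') (fun ys => Ret (y :: ys)))
  else Ret [::].

Definition better X (F : X -> prog R) (A B : X) : prog X :=
  bind (F A) (fun a => bind (F B) (fun b => Ret (if a < b then B else A))).

Variables (f : {set N} -> R) (I : {set {set N}}).

Fixpoint run X (p : prog X) : X :=
  match p with
  | Ret x => x
  | Value Q next => run (next (f Q))
  | Indep Q next => run (next (Q \in I))
  end.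

Fixpoint cost X (p : prog X) : nat :=
  match p with
  | Ret x => 0
  | Value Q next => (cost (next (f Q))).+1
  | Indep Q next => (cost (next (Q \in I))).+1
  end.

Lemma output_compile p : output f I (compile p) = run p.
Proof. by elim: p => //= Q next IH; rewrite IH. Qed.

Lemma queries_compile p : queries f I (compile p) = cost p.
Proof. by elim: p => //= Q next IH; rewrite IH. Qed.

Lemma run_bind X Y (p : prog X) (k : X -> prog Y) : run (bind p k) = run (k (run p)).
Proof. by elim: p => //= Q next IH; rewrite IH. Qed.

Lemma cost_bind X Y (p : prog X) (k : X -> prog Y) :
  cost (bind p k) = (cost p + cost (k (run p)))%N.
Proof. by elim: p => //= Q next IH; rewrite IH. Qed.

Lemma run_mapM X Y (c : X -> prog Y) s : run (mapM c s) = [seq run (c x) | x <- s].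
Proof. by elim: s => //= x s IH; rewrite !run_bind /= IH. Qed.

Lemma cost_mapM X Y (c : X -> prog Y) s m :
  (forall x, cost (c x) = m) -> cost (mapM c s) = (size s * m)%N.
Proof. by move=> cm; elim: s => //= x s IH; rewrite !cost_bind /= cm IH addn0. Qed.

Lemma run_better X (F : X -> prog R) A B :
  run (better F A B) = if run (F A) < run (F B) then B else A.
Proof. by rewrite /better !run_bind. Qed.

Lemma cost_better X (F : X -> prog R) A B :
  cost (better F A B) = (cost (F A) + cost (F B))%N.
Proof. by rewrite /better !cost_bind /= addn0. Qed.

Lemma run_better_ge X (F : X -> prog R) A B :
  let v C := run (F C) in v A <= v (run (better F A B)) /\ v B <= v (run (better F A B)).
Proof. by rewrite run_better /=; case: ltP => [/ltW|]. Qed.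

Lemma run_better_in X (P : X -> Prop) (F : X -> prog R) A B :
  P A -> P B -> P (run (better F A B)).
Proof. by rewrite run_better; case: ifP. Qed.

End Programs.

Arguments Ret {R N X} x.

(** * Exchanges in matroids *)

Section Exchange.
Variables (E : finType) (I : {set {set E}}).
Hypothesis matI : matroid I.

Lemma indep_sub (S T : {set E}) : T \in I -> S \subset T -> S \in I.
Proof. by case: matI => _ down _; apply: down. Qed.

Lemma indep0 : set0 \in I.
Proof.
case: matI => /set0Pn[S SI] down _.
by apply: down SI _; rewrite sub0set.
Qed.

Lemma indep_augment (S T : {set E}) : S \in I -> T \in I -> (#|S| <= #|T|)%N ->
  exists Z : {set E}, [/\ Z \in I, S \subset Z, Z \subset S :|: T & #|Z| = #|T|].
Proof.
have [m] := ubnP (#|T| - #|S|)%N; elim: m S => // m IH S lt_m SI TI.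
rewrite leq_eqVlt => /orP[/eqP eqST|ltST].
  by exists S; split; rewrite ?subsetUl.
have [_ _ /(_ S T SI TI ltST)[x]] := matI.
rewrite inE => /andP[xNS xT] xSI.
have [||//||Z [ZI sZ Zs cZ]] := IH (x |: S).
- by rewrite cardsU1 xNS; lia.
- by [].
- by rewrite cardsU1 xNS; lia.
exists Z; split=> //; first by apply: subset_trans sZ; apply: subsetUr.
apply: (subset_trans Zs); rewrite -setUA subUset sub1set.
by rewrite !inE xT orbT subxx.
Qed.

Definition is_base (S : {set E}) := S \in I /\ forall T : {set E}, T \in I -> (#|T| <= #|S|)%N.

Lemma base_card (S T : {set E}) : is_base S -> T \in I -> #|T| = #|S| -> is_base T.
Proof. by move=> [_ maxS] TI eqTS; split=> // V VI; rewrite eqTS maxS. Qed.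

Lemma base_dep (S : {set E}) y : is_base S -> y \notin S -> y |: S \notin I.
Proof.
move=> [_ maxS] yNS; apply/negP => /maxS; rewrite cardsU1 yNS; lia.
Qed.

Lemma card_swap (S : {set E}) x y : x \in S -> y \notin S -> #|y |: S :\ x| = #|S|.
Proof. by move=> xS yNS; rewrite cardsU1 !inE (negPf yNS) andbF (cardsD1 x S) xS. Qed.

(* Growing [y |: P] to a base inside [y |: S] leaves out a single element of [S]. *)
Lemma base_swap (S P : {set E}) y : is_base S -> y \notin S -> P \subset S ->
  y |: P \in I -> exists z, [/\ z \in S :\: P & y |: S :\ z \in I].
Proof.
move=> baseS yNS sPS yPI.
have [SI maxS] := baseS.
have [Z [ZI sZ Zs cZ]] := indep_augment yPI SI (maxS _ yPI).
have sZyS : Z \subset y |: S.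
  by apply: (subset_trans Zs); rewrite -setUA (setUidPr sPS).
have yZ : y \in Z by rewrite (subsetP sZ) // setU11.
have cyS : #|y |: S| = #|S|.+1 by rewrite cardsU1 yNS.
have /cards1P[z Dz] : #|(y |: S) :\: Z| == 1%N.
  by rewrite cardsD (setIidPr sZyS) cZ cyS subSnn.
have : z \in (y |: S) :\: Z by rewrite Dz set11.
rewrite !inE => /andP[zNZ /predU1P[zy|zS]]; first by rewrite zy yZ in zNZ.
exists z; split.
  rewrite !inE zS andbT; apply: contra zNZ => zP.
  by rewrite (subsetP sZ) // !inE zP orbT.
suff -> : y |: S :\ z = Z by [].
apply/eqP; rewrite eq_sym eqEcard card_swap // cZ leqnn andbT.
apply/subsetP => t tZ; have := subsetP sZyS t tZ; rewrite !inE.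
by case: eqP => //= _ ->; rewrite andbT; apply: contraTneq tZ => ->.
Qed.

Lemma symmetric_exchange (S V : {set E}) t : is_base S -> V \in I -> t \in V -> t \notin S ->
  exists x, [/\ x \in S, x \notin V, t |: S :\ x \in I & x |: V :\ t \in I].
Proof.
move=> baseS VI tV tNS.
pose X := [set x in S | t |: S :\ x \in I].
have sXS : X \subset S by apply/subsetP => x; rewrite inE => /andP[].
have [SI _] := baseS.
have XI : X \in I := indep_sub SI sXS.
have VtI : V :\ t \in I by apply: indep_sub VI _; apply: subsetDl.
case: (pickP [pred x in X | (x \notin V) && (x |: V :\ t \in I)]) => [x|none].
  by rewrite !inE => /and3P[/andP[? ?] ? ?]; exists x.
have tXD : t |: X \notin I.
  apply/negP => /(base_swap baseS tNS sXS)[z []].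
  by rewrite !inE => /andP[/nandP[/negPf->//|/negPf->]].
have maxX (W : {set E}) : W \in I -> W \subset V :\ t :|: X -> (#|W| <= #|V :\ t|)%N.
  move=> WI sW; rewrite leqNgt; apply/negP => lt.
  have [_ _ /(_ _ _ VtI WI lt)[x]] := matI.
  rewrite inE => /andP[xNV xW] xI.
  have := subsetP sW x xW; rewrite inE (negPf xNV) /= => xX.
  have := none x; rewrite /= xX xI andbT /=.
  move: xNV; rewrite !inE negb_and negbK => /orP[/eqP xt|-> //].
  by move: tNS; rewrite -xt (subsetP sXS).
have [Y [YI sXY Ys cY]] := indep_augment XI VtI (maxX _ XI (subsetUr _ _)).
have lt : (#|Y| < #|V|)%N by rewrite cY (cardsD1 t V) tV.
have [_ _ /(_ _ _ YI VI lt)[v]] := matI.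
rewrite inE => /andP[vNY vV] vYI.
have [vt|vt] := eqVneq v t.
  case/negP: tXD; apply: indep_sub vYI _; rewrite vt.
  by apply: setUS.
have: (#|v |: Y| <= #|V :\ t|)%N.
  apply: maxX => //; rewrite subUset sub1set !inE vt vV /=.
  by rewrite setUC.
by rewrite cardsU1 vNY cY add1n ltnn.
Qed.

Lemma exchange_injection (S V : {set E}) : is_base S -> V \in I ->
  exists h : E -> E, [/\ {in V &, injective h}, {in V, forall u, h u \in S},
    {in V, forall u, u |: S :\ h u \in I} & {in V :&: S, forall u, h u = u}].
Proof.
move=> baseS; have [m] := ubnP #|V :\: S|; elim: m V => // m IH V lt_m VI.
have [/eqP|[t]] := set_0Vmem (V :\: S).
  rewrite setD_eq0 => sVS; exists id; split=> // u uV; first exact: (subsetP sVS).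
  by rewrite setD1K ?(subsetP sVS) //; case: baseS.
rewrite inE => /andP[tNS tV].
have [x [xS xNV txI xtI]] := symmetric_exchange baseS VI tV tNS.
have [//|h [injh hS hI hid]] := IH (x |: V :\ t) _ xtI.
  apply: leq_trans (_ : #|V :\: S| <= m)%N => //.
  apply: proper_card; apply/properP; split; last first.
    by exists t; rewrite !inE ?eqxx tNS ?tV //= orbF; apply: contraNneq xNV => <-.
  apply/subsetP => u; rewrite !inE => /andP[uNS /predU1P[ux|/andP[_ ->]]]; last by rewrite uNS.
  by rewrite ux xS in uNS.
have inV' u : u \in V -> u != t -> u \in x |: V :\ t by rewrite !inE => -> ->; rewrite orbT.
have hx : h x = x by apply: hid; rewrite !inE eqxx xS.
have xV' : x \in x |: V :\ t by rewrite setU11.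
have hNx u : u \in V -> u != t -> h u != x.
  move=> uV ut; apply: contraNneq xNV => hux.
  by rewrite -(injh u x (inV' u uV ut) xV' _) // hux hx.
exists (fun u => if u == t then x else h u); split.
- move=> u v uV vV; case: eqVneq => [->|ut]; case: eqVneq => [->|vt] //.
  + by move/esym/eqP; rewrite (negPf (hNx _ _ _)).
  + by move/eqP; rewrite (negPf (hNx _ _ _)).
  + by apply: injh; apply: inV'.
- by move=> u uV; case: eqVneq => // ut; apply/hS/inV'.
- by move=> u uV; case: eqVneq => [->|ut] //; apply/hI/inV'.
- move=> u; rewrite inE => /andP[uV uS]; case: eqVneq => [ut|ut].
    by rewrite -ut uS in tNS.
  by apply: hid; rewrite inE uS inV'.
Qed.

End Exchange.

(** * The potential *)

Section Submodular.
Variables (R : realType) (E : finType) (F : {set E} -> R).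
Hypotheses (monF : monotone F) (subF : submodular F).

Lemma sum_gain_ge (S V : {set E}) :
  F (S :|: V) - F S <= \sum_(u in V) (F (u |: S) - F S).
Proof.
have [m] := ubnP #|V|; elim: m V => // m IH V.
have [->|[u uV]] := set_0Vmem V; first by rewrite setU0 big_set0 subrr.
rewrite (cardsD1 u) uV add1n ltnS (big_setD1 _ uV) /= => /IH.
have := subF (u |: S) (S :|: V :\ u).
have -> : u |: S :|: (S :|: V :\ u) = S :|: V.
  by rewrite -setUA setUC !setUA setUid -setUA [_ :|: [set u]]setUC setD1K.
have : F S <= F ((u |: S) :&: (S :|: V :\ u)).
  by apply: monF; rewrite subsetI subsetUr subsetUl.
lra.
Qed.

Lemma sum_loss_le (S V : {set E}) :
  \sum_(x in V) (F S - F (S :\ x)) <= F S - F (S :\: V).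
Proof.
have [m] := ubnP #|V|; elim: m V => // m IH V.
have [->|[u uV]] := set_0Vmem V; first by rewrite setD0 big_set0 subrr.
rewrite (cardsD1 u) uV add1n ltnS (big_setD1 _ uV) /= => /IH.
have := subF (S :\ u) (S :\: (V :\ u)).
rewrite -setDUr setD1K // -setDIr.
have -> : [set u] :&: (V :\ u) = set0.
  by apply/setP => x; rewrite !inE; case: eqP.
rewrite setD0; lra.
Qed.

Lemma swap_gain_ge (S : {set E}) x y : x \in S ->
  F (y |: S) - F S - (F S - F (S :\ x)) <= F (y |: S :\ x) - F S.
Proof.
move=> xS; have := subF (y |: S :\ x) S.
rewrite -setUA [S :\ x :|: S](setUidPr (subsetDl _ _)).
have : F (S :\ x) <= F ((y |: S :\ x) :&: S).
  by apply: monF; rewrite subsetI subsetUr subsetDl.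
lra.
Qed.

End Submodular.

Section Potential.
Variables (R : realType) (N : finType) (l : nat) (f : {set N} -> R).
Hypotheses (f0 : nonnegative f) (monf : monotone f) (subf : submodular f).
Local Notation L := l.+1.
Local Notation E := (N * 'I_L)%type.
Implicit Types (J : {set 'I_L}) (S : {set E}).

Definition part (J : {set 'I_L}) (S : {set E}) : {set N} :=
  [set e.1 | e in S & e.2 \in J].

Definition growth : R := 1 + L%:R^-1.

(* [weight 0] is a junk value: it is only applied to the empty part and shifts the
   potential by a constant. *)
Definition weight (i : nat) : R := growth ^+ i.-1 / 'C(l, i.-1)%:R.

Definition potential (S : {set E}) : R :=
  \sum_(J : {set 'I_L}) weight #|J| * f (part J S).

Lemma in_part J S v : reflect (exists2 j, j \in J & (v, j) \in S) (v \in part J S).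
Proof.
apply: (iffP imsetP) => [[[u j]]|[j jJ vjS]].
  by rewrite inE /= => /andP[ujS jJ] ->; exists j.
by exists (v, j); rewrite // inE vjS.
Qed.

Lemma partS J (S T : {set E}) : S \subset T -> part J S \subset part J T.
Proof.
move=> /subsetP sST; apply/subsetP => v /in_part[j jJ vjS].
by apply/in_part; exists j; rewrite ?sST.
Qed.

Lemma partU J (S T : {set E}) : part J (S :|: T) = part J S :|: part J T.
Proof.
apply/setP => v; rewrite inE; apply/in_part/orP => [[j jJ]|].
  by rewrite inE => /orP[]; [left|right]; apply/in_part; exists j.
by case=> /in_part[j jJ vj]; exists j; rewrite // inE vj ?orbT.
Qed.

Lemma part_setT S : part setT S = [set e.1 | e in S].
Proof.
by apply/setP => v; apply/imsetP/imsetP => -[e eS ->]; exists e; move: eS; rewrite // !inE andbT.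
Qed.

Lemma part_color J S j : part J (S :\: [set e | e.2 == j]) = part (J :\ j) S.
Proof.
apply/setP => v; apply/in_part/in_part => [[i iJ]|[i]]; rewrite !inE /=.
  by case/andP=> ij viS; exists i; rewrite // !inE ij.
by case/andP=> ij iJ viS; exists i; rewrite // !inE ij.
Qed.

Lemma part_monotone J : monotone (f \o part J).
Proof. by move=> S T sST; apply/monf/partS. Qed.

Lemma part_submodular J : submodular (f \o part J).
Proof.
move=> S T /=; rewrite partU; apply: le_trans (subf _ _); rewrite lerD2r.
by apply: monf; rewrite subsetI !partS ?subsetIl ?subsetIr.
Qed.

Lemma growth_gt0 : 0 < growth.
Proof. by rewrite ltr_wpDr ?invr_ge0. Qed.

Lemma weight_ge0 i : 0 <= weight i.
Proof. by rewrite divr_ge0 // exprn_ge0 // ltW ?growth_gt0. Qed.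

Lemma potential_ge0 : nonnegative potential.
Proof. by move=> S; apply: sumr_ge0 => J _; rewrite mulr_ge0 ?weight_ge0. Qed.

Lemma potential_monotone : monotone potential.
Proof.
move=> S T sST; apply: ler_sum => J _; apply: ler_wpM2l; first exact: weight_ge0.
exact: part_monotone.
Qed.

Lemma potential_submodular : submodular potential.
Proof.
move=> S T; rewrite -!big_split /=; apply: ler_sum => J _; rewrite -!mulrDr.
by apply: ler_wpM2l; first exact: weight_ge0; apply: part_submodular.
Qed.

Lemma sum_by_card (G : nat -> R) :
  \sum_(J : {set 'I_L}) G #|J| = \sum_(i < L.+1) 'C(L, i)%:R * G i.
Proof.
rewrite (partition_big (fun J : {set 'I_L} => inord #|J| : 'I_L.+1) xpredT) //=.
apply: eq_bigr => i _; have := cards_draws [set: 'I_L] i.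
rewrite cardsT card_ord => <-; rewrite mulr_natl -sumr_const.
have cardJ (J : {set 'I_L}) : (#|J| < L.+1)%N by rewrite ltnS -[leqRHS]card_ord max_card.
apply: eq_big => J; last by move/eqP <-; rewrite inordK.
rewrite inE subsetT /=; apply/eqP/eqP => [<-|cJ]; first by rewrite inordK.
by apply: val_inj; rewrite /= inordK.
Qed.

(* The weights solve the recurrence that cancels every intermediate part of the
   solution in the local optimality condition. *)
Lemma weight_rec i : (0 < i < L)%N ->
  L.+1%:R * (i%:R * weight i) = L%:R * ((L - i)%:R * weight i.+1).
Proof.
case: i => // i /=; rewrite ltnS => ltil.
rewrite /weight /= subSS.
have := congr1 (fun n => n%:R : R) (mul_bin_left l i); rewrite !natrM.
have := bin_gt0 l i; rewrite (ltnW ltil) -(ltr0n R) => /lt0r_neq0 n1.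
have := bin_gt0 l i.+1; rewrite ltil -(ltr0n R) => /lt0r_neq0 n2 e.
have nL : L%:R != 0 :> R by rewrite pnatr_eq0.
have q : L%:R * growth = L.+1%:R by rewrite /growth mulrDr mulfV // mulr1 natr1.
rewrite exprSr -q.
have {}e : i.+1%:R / 'C(l, i)%:R = (l - i)%:R / 'C(l, i.+1)%:R :> R.
  by apply/eqP; rewrite eqr_div // e.
transitivity (L%:R * growth * growth ^+ i * (i.+1%:R / 'C(l, i)%:R)); first by ring.
by rewrite e; ring.
Qed.

Lemma sum_weight : \sum_(J : {set 'I_L}) #|J|%:R * weight #|J| = L%:R ^+ 2 * (growth ^+ L - 1).
Proof.
rewrite (sum_by_card (fun i => i%:R * weight i)) big_ord_recl /= mul0r mulr0 add0r.
have nL : L%:R != 0 :> R by rewrite pnatr_eq0.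
rewrite subrX1 /growth [1 + _ - 1]addrC addKr mulrA expr2 mulfK // mulr_sumr.
apply: eq_bigr => i _. rewrite /weight /bump leq0n add1n /=.
have := bin_gt0 l i; rewrite (leq_ord i) -(ltr0n R) => /lt0r_neq0 n1.
have := congr1 (fun n => n%:R : R) (mul_bin_diag L i); rewrite !natrM /= => e.
by rewrite mulrA [_ * i.+1%:R]mulrC -e -/growth; field.
Qed.

Lemma potential_gain_ge (S : {set E}) (T : {set N}) j :
  \sum_(J : {set 'I_L} | j \in J) weight #|J| * (f T - f (part J S)) <=
  \sum_(u in T) (potential ((u, j) |: S) - potential S).
Proof.
under [leRHS]eq_bigr do rewrite -sumrB.
rewrite exchange_big /= big_mkcond /=; apply: ler_sum => J _.
under eq_bigr do rewrite -mulrBr.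
rewrite -mulr_sumr; case: ifP => jJ; last first.
  apply: mulr_ge0 (weight_ge0 _) _; apply: sumr_ge0 => u _.
  by rewrite subr_ge0; apply: monf (partS _ (subsetUr _ _)).
apply: ler_wpM2l; first exact: weight_ge0.
have := @sum_gain_ge _ _ _ (@part_monotone J) (@part_submodular J) S [set (u, j) | u in T].
rewrite big_imset => [/=|u v _ _ [] //]; apply: le_trans; rewrite lerD2r.
apply: monf; apply/subsetP => u uT; apply/in_part; exists j => //.
by rewrite inE (imset_f (fun u => (u, j))) ?orbT.
Qed.

Lemma potential_loss_le (S : {set E}) :
  \sum_(x in S) (potential S - potential (S :\ x)) <=
  \sum_(J : {set 'I_L}) (#|J|%:R * weight #|J| - (L - #|J|)%:R * weight #|J|.+1) * f (part J S).
Proof.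
apply: le_trans (_ : _ <= \sum_(J : {set 'I_L}) \sum_(j in J)
    weight #|J| * (f (part J S) - f (part (J :\ j) S))) _.
  under eq_bigr do rewrite -sumrB.
  rewrite exchange_big /=; apply: ler_sum => J _.
  under eq_bigr do rewrite -mulrBr.
  rewrite -!mulr_sumr; apply: ler_wpM2l; first exact: weight_ge0.
  rewrite (partition_big snd xpredT) //= [leRHS]big_mkcond /=; apply: ler_sum => j _.
  have := @sum_loss_le _ _ _ (@part_submodular J) S (S :&: [set e | e.2 == j]).
  rewrite setDIr setDv set0U /= part_color.
  under eq_bigl do rewrite !inE.
  by case: ifP => // jJ; rewrite (setDidPl _) ?subrr // disjoint_sym disjoints1 jJ.
under eq_bigr do under eq_bigr do rewrite mulrBr.
under eq_bigr do rewrite sumrB sumr_const -mulr_natl mulrA.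
rewrite sumrB; under [leRHS]eq_bigr do rewrite mulrBl.
rewrite [leRHS]sumrB lerD2l lerN2 le_eqVlt; apply/orP; left; apply/eqP.
rewrite (exchange_big_dep xpredT) //=.
transitivity (\sum_(j : 'I_L) \sum_(J : {set 'I_L} | j \notin J) weight #|J|.+1 * f (part J S)).
  rewrite (exchange_big_dep xpredT) //=; apply: eq_bigr => J _; rewrite sumr_const.
  rewrite -[RHS]mulr_natl [RHS]mulrA; congr (_%:R * _ * _).
  suff sub c : c = L -> (c - #|J|)%N = #|[predC J]| by exact: sub.
  by move=> ->; apply/esym/(canRL (addKn _)); have := cardC J; rewrite card_ord.
apply: eq_bigr => j _.
rewrite [RHS](reindex_onto (fun J => j |: J) (fun J => J :\ j)) => [|J jJ]; last by rewrite setD1K.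
apply: eq_big => J; last by move=> jNJ; rewrite cardsU1 jNJ setU1K.
rewrite setU11 /=; apply/idP/eqP => [/setU1K//|<-].
by rewrite !inE eqxx.
Qed.

Lemma local_search_bound (S : {set E}) (T : {set N}) :
  L%:R ^+ 2 * (growth ^+ L - 1) * f T <=
  L%:R ^+ 2 * growth ^+ L * f [set e.1 | e in S] +
  \sum_(j : 'I_L) (\sum_(u in T) (potential ((u, j) |: S) - potential S)
                   - \sum_(x in S) (potential S - potential (S :\ x))).
Proof.
rewrite sumrB sumr_const card_ord -[X in _ + (_ - X)]mulr_natl.
have gain : \sum_(J : {set 'I_L}) #|J|%:R * weight #|J| * (f T - f (part J S)) <=
    \sum_j \sum_(u in T) (potential ((u, j) |: S) - potential S).
  apply: le_trans (ler_sum _ (fun j _ => potential_gain_ge S T j)).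
  rewrite (exchange_big_dep xpredT) //=; apply: ler_sum => J _.
  by rewrite sumr_const -[leRHS]mulr_natl [leRHS]mulrA.
have := ler_wpM2l (ler0n R L) (potential_loss_le S).
set loss := L%:R * \sum_(x in S) _ => lossle.
suff : \sum_(J : {set 'I_L}) #|J|%:R * weight #|J| * f T <=
  L%:R ^+ 2 * growth ^+ L * f [set e.1 | e in S] +
  (\sum_(J : {set 'I_L}) #|J|%:R * weight #|J| * (f T - f (part J S)) - 
  L%:R * \sum_(J : {set 'I_L})
    (#|J|%:R * weight #|J| - (L - #|J|)%:R * weight #|J|.+1) * f (part J S)).
  by rewrite -mulr_suml sum_weight => /le_trans; apply; lra.
rewrite mulr_sumr -sumrB addrC -lerBlDl -sumrB (bigD1 setT) //= part_setT.
rewrite cardsT card_ord subnn mul0r subr0.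
have -> : L%:R * weight L * f T - (L%:R * weight L * (f T - f [set e.1 | e in S])
    - L%:R * (L%:R * weight L * f [set e.1 | e in S])) =
   L%:R ^+ 2 * growth ^+ L * f [set e.1 | e in S].
  rewrite /weight /= binn divr1.
  have nL : L%:R != 0 :> R by rewrite pnatr_eq0.
  have -> : L%:R ^+ 2 * growth ^+ L = L%:R * (L%:R + 1) * growth ^+ l.
    by rewrite [growth ^+ _]exprS mulrA {1}/growth; congr (_ * _); field; rewrite nat1r pnatr_eq0.
  by ring.
rewrite gerDl; apply: sumr_le0 => J JT.
have [-> |J0] := eqVneq #|J| 0%N.
  rewrite !mul0r subn0 !sub0r mulNr mulrN !opprK oppr_le0.
  exact: mulr_ge0 (ler0n _ _) (mulr_ge0 (mulr_ge0 (ler0n _ _) (weight_ge0 _)) (f0 _)).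
have ltJ : (#|J| < L)%N by rewrite -[ltnRHS]card_ord -cardsT proper_card // properT.
have := @weight_rec #|J|; rewrite lt0n J0 ltJ => /(_ isT).
rewrite -natr1 => rec.
have -> : forall a d t p : R, d * t - (d * (t - p) - L%:R * ((d - a) * p)) =
    ((L%:R + 1) * d - L%:R * a) * p by move=> *; ring.
by rewrite rec subrr mul0r.
Qed.

End Potential.

(** * Expectations under uniform draws *)

Section Averages.
Variable R : realType.

Definition avg (W : finType) (F : W -> R) : R := (\sum_w F w) / #|W|%:R.

Section Avg.
Variable W : finType.
Implicit Types F G : W -> R.

Lemma eq_avg F G : F =1 G -> avg F = avg G.
Proof. by move=> eqFG; rewrite /avg (eq_bigr G). Qed.

Lemma ler_avg F G : (forall w, F w <= G w) -> avg F <= avg G.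
Proof. by move=> leFG; rewrite ler_wpM2r ?invr_ge0 ?ler0n // ler_sum. Qed.

Lemma avgD F G : avg (fun w => F w + G w) = avg F + avg G.
Proof. by rewrite /avg big_split mulrDl. Qed.

Lemma avgZ c F : avg (fun w => c * F w) = c * avg F.
Proof. by rewrite /avg -mulr_sumr mulrA. Qed.

Lemma avg_const c : (0 < #|W|)%N -> avg (fun _ : W => c) = c.
Proof.
by move=> W0; rewrite /avg sumr_const -[c *+ _]mulr_natr mulfK // pnatr_eq0 -lt0n.
Qed.

End Avg.

Lemma avg_pair (W1 W2 : finType) (F : W1 -> W2 -> R) :
  avg (fun w : W1 * W2 => F w.1 w.2) = avg (fun w1 => avg (F w1)).
Proof.
rewrite /avg -(pair_big xpredT xpredT F) /= -mulr_suml card_prod natrM invfM.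
by rewrite mulrA mulrAC.
Qed.

Lemma avg_modn (d D : nat) (F : nat -> R) : (0 < d)%N -> (0 < D)%N -> (d %| D)%N ->
  avg (fun s : 'I_D => F (s %% d)%N) = avg (fun i : 'I_d => F i).
Proof.
move=> d0 D0 /dvdnP[m Dm].
have sum_block : \sum_(s < m * d) F (s %% d)%N = m%:R * \sum_(i < d) F i.
  elim: {D D0 Dm} m => [|m IH]; first by rewrite mul0n big_ord0 mul0r.
  rewrite -natr1 mulrDl -IH mul1r -!(big_mkord xpredT (fun s => F (s %% d)%N)).
  rewrite mulSnr (big_cat_nat (n := (m * d)%N)) ?leq_addr //=; congr (_ + _).
  rewrite -{1}[(m * d)%N]add0n big_addn addKn big_mkord.
  by apply: eq_bigr => i _; rewrite addnC modnMDl modn_small.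
rewrite /avg !card_ord Dm sum_block natrM invfM mulrACA mulfV ?mul1r //.
by rewrite pnatr_eq0; apply: contraTneq D0 => m0; rewrite Dm m0.
Qed.

Fixpoint avgs (W : finType) (k : nat) (F : seq W -> R) : R :=
  if k is k'.+1 then avg (fun w => avgs k' (fun ws => F (w :: ws))) else F [::].

Section Avgs.
Variable W : finType.
Hypothesis W_gt0 : (0 < #|W|)%N.
Implicit Types F G : seq W -> R.

Lemma ler_avgs k F G : (forall ws, size ws = k -> F ws <= G ws) -> avgs k F <= avgs k G.
Proof.
elim: k F G => /= [|k IH] F G leFG; first exact: leFG.
by apply: ler_avg => w; apply: IH => ws sz; apply: leFG; rewrite /= sz.
Qed.

Lemma eq_avgs k F G : F =1 G -> avgs k F = avgs k G.
Proof.
elim: k F G => /= [|k IH] F G eqFG; first exact: eqFG.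
by apply: eq_avg => w; apply: IH => ws; apply: eqFG.
Qed.

Lemma avgsD k F G : avgs k (fun ws => F ws + G ws) = avgs k F + avgs k G.
Proof.
by elim: k F G => //= k IH F G; rewrite -avgD; apply: eq_avg => w; apply: IH.
Qed.

Lemma avgsZ k c F : avgs k (fun ws => c * F ws) = c * avgs k F.
Proof.
by elim: k F => //= k IH F; rewrite -avgZ; apply: eq_avg => w; apply: IH.
Qed.

Lemma avgs_const k c : avgs k (fun _ : seq W => c) = c.
Proof. by elim: k => //= k IH; rewrite (eq_avg (fun _ => IH)) avg_const. Qed.

Lemma avgs_take a k F : (a <= k)%N -> avgs k (fun ws => F (take a ws)) = avgs a F.
Proof.
elim: k a F => [|k IH] [|a] F //= ak; first by rewrite avg_const ?avgs_const.
by apply: eq_avg => w; apply: (IH a (fun ws => F (w :: ws))).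
Qed.

Lemma avg_tuple k F : avg (fun t : k.-tuple W => F t) = avgs k F.
Proof.
elim: k F => [|k IH] F.
  rewrite /avg /= card_tuple expn0 divr1 (eq_bigr (fun _ => F [::])) => [|t _].
    by rewrite sumr_const card_tuple.
  by rewrite tuple0.
rewrite /= -(eq_avg (fun w => IH (fun ws => F (w :: ws)))).
rewrite -(avg_pair (fun w (t : k.-tuple W) => F (w :: t))) /avg; congr (_ / _%:R).
  rewrite (reindex (fun p : W * k.-tuple W => [tuple of p.1 :: p.2])) //=.
  exists (fun t => (thead t, [tuple of behead t])) => [[w t] _|t _].
    by congr pair; apply: val_inj.
  by rewrite [RHS]tuple_eta; apply: val_inj.
by rewrite card_prod !card_tuple expnS.
Qed.

Lemma avgs_count k (A : {pred W}) :
  avgs k (fun ws => (count [in A] ws)%:R) = k%:R * (#|A|%:R / #|W|%:R).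
Proof.
elim: k => [|k IH] /=; first by rewrite mul0r.
under eq_avg do under eq_avgs do rewrite natrD.
under eq_avg do rewrite avgsD avgs_const IH.
rewrite avgD avg_const // -natr1 mulrDl mul1r addrC; congr (_ + _).
by rewrite /avg -natr_sum -sum1_card [in RHS]big_mkcond.
Qed.

(* Among few draws from a set [A] of small density, collisions in [A] are rare
   enough for the expected maximum to be at least half the expected sum. *)
Lemma avgs_max_ge (A : {pred W}) (z : W -> R) k :
  (forall w, 0 <= z w) -> (forall w, w \notin A -> z w = 0) ->
  (2 * k.-1 * #|A| <= #|W|)%N ->
  k%:R / 2 * avg z <= avgs k (fun ws => \big[Num.max/0]_(w <- ws) z w).
Proof.
move=> z0 zA; elim: k => [|k IH] /= sparse; first by rewrite !mul0r big_nil.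
have {}IH : k%:R / 2 * avg z <= avgs k (fun ws => \big[Num.max/0]_(w <- ws) z w).
  by apply: IH; apply: leq_trans sparse; rewrite leq_mul2r leq_mul2l leq_pred !orbT.
have max0 (ws : seq W) : 0 <= \big[Num.max/0]_(w <- ws) z w by apply: bigmax_ge_id.
have zavg : 0 <= avg z by rewrite divr_ge0 ?sumr_ge0.
apply: le_trans (_ : avg (fun w => avgs k (fun ws => \big[Num.max/0]_(w <- ws) z w
    + z w * (1 + -1 * (count [in A] ws)%:R))) <= _); last first.
  apply: ler_avg => w; apply: ler_avgs => ws _; rewrite big_cons.
  have [hasA|/hasPn noA] := boolP (has [in A] ws).
    apply: le_trans (_ : \big[Num.max/0]_(v <- ws) z v <= _); last by rewrite le_max lexx orbT.
    rewrite gerDl mulr_ge0_le0 // mulN1r subr_le0.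
    by rewrite ler1n -has_count.
  have -> : count [in A] ws = 0%N by apply/eqP; rewrite -leqn0 leqNgt -has_count; apply/hasPn.
  rewrite mulr0 addr0 mulr1 le_max gerDr; apply/orP; left.
  by rewrite big_seq; apply: bigmax_le => // v /noA /zA ->.
have countE : avgs k (fun ws => 1 + -1 * (count [in A] ws)%:R) =
    1 - k%:R * (#|A|%:R / #|W|%:R) :> R.
  by rewrite (avgsD k (fun=> 1)) avgsZ avgs_const avgs_count mulN1r.
under [leRHS]eq_avg do rewrite avgsD avgsZ countE.
rewrite avgD avg_const //; under [X in _ + X]eq_avg do rewrite mulrC.
rewrite avgZ -natr1 mulrDl mulrDl lerD // mul1r; apply: ler_wpM2r => //.
have W0 : 0 < #|W|%:R :> R by rewrite ltr0n.
have : k%:R * (#|A|%:R / #|W|%:R) <= 2^-1 :> R.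
  rewrite mulrA ler_pdivrMr // ler_pdivlMl // -!natrM ler_nat mulnA.
  exact: sparse.
lra.
Qed.

End Avgs.

End Averages.

(** * Local search *)

Section LocalSearch.
Variables (R : realType) (N E : finType).
Local Notation prog := (prog R N).
Variables (gval : {set E} -> prog R) (ind : {set E} -> prog bool) (fuel : nat).

Fixpoint bsearch (test : nat -> prog bool) j pos : prog nat :=
  if j is i.+1 then
    bind (test (pos + 2 ^ i)%N)
      (fun c : bool => bsearch test i (if c then pos + 2 ^ i else pos)%N)
  else Ret pos.

(* [s] lists candidates for removal by decreasing loss. The search finds the last one
   whose removal, together with that of all later ones, makes room for [y]. *)
Definition exchange (S : {set E}) (s : seq E) (y : E) : prog {set E} :=
  if y \in S then Ret S else
  let probe k := ind (y |: S :\: [set x in drop k s]) in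
  bind (probe 0%N) (fun c : bool =>
    if c then bind (bsearch probe fuel 0) (fun k => Ret (y |: S :\ nth y s k)) else Ret S).

Definition best_exchange (S : {set E}) (s : seq E) : seq E -> prog {set E} :=
  foldr (fun y p => bind (exchange S s y) (fun A => bind p (better gval A))) (Ret S).

Definition step (X Y : seq E) (S : {set E}) : prog {set E} :=
  bind (mapM (fun x => gval (S :\ x)) X) (fun vals =>
    best_exchange S (unzip1 (sort (fun p q => p.2 <= q.2) (zip X vals))) Y).

Variables (f : {set N} -> R) (I : {set {set N}}).
Local Notation run := (run f I).
Local Notation cost := (cost f I).

Lemma run_bsearch (P : pred nat) test j pos : (forall k, run (test k) = P k) ->
  P pos -> ~~ P (pos + 2 ^ j)%N ->
  let k := run (bsearch test j pos) in P k /\ ~~ P k.+1.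
Proof.
move=> testP; elim: j pos => [|j IH] pos /= Pp; first by rewrite expn0 addn1.
rewrite expnS mul2n -addnn addnA run_bind testP => nP.
by case: ifP => [Pm|/negbT Pm]; apply: IH.
Qed.

Lemma cost_bsearch test j pos : (forall k, cost (test k) <= 1)%N ->
  (cost (bsearch test j pos) <= j)%N.
Proof.
move=> test1; elim: j pos => //= j IH pos; rewrite cost_bind.
exact: (leq_add (test1 _) (IH _)).
Qed.

Variables (M : {set {set E}}) (g : {set E} -> R) (G : nat).
Hypotheses (matM : matroid M) (mong : monotone g) (subg : submodular g).
Hypotheses (run_gval : forall S, run (gval S) = g S) (cost_gval : forall S, cost (gval S) = G).
Hypotheses (run_ind : forall S, run (ind S) = (S \in M)).
Hypotheses (cost_ind : forall S, (cost (ind S) <= 1)%N).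
Hypothesis fuel_big : (#|E| <= 2 ^ fuel)%N.

Lemma cost_exchange S s y : (cost (exchange S s y) <= fuel.+1)%N.
Proof.
rewrite /exchange; case: ifP => // _; rewrite cost_bind (leq_add (cost_ind _)) //.
by case: ifP => // _; rewrite cost_bind addn0 cost_bsearch.
Qed.

Lemma cost_step X Y S : (cost (step X Y S) <= size X * G + size Y * (fuel.+1 + 2 * G))%N.
Proof.
rewrite /step cost_bind (cost_mapM _ (fun x => cost_gval (S :\ x))) leq_add2l.
elim: Y => //= y Y IH; rewrite 2!cost_bind cost_better !cost_gval mulSn.
apply: leq_trans (leq_add (cost_exchange _ _ _) (leq_add IH (leqnn _))) _.
by rewrite [leqRHS]addnAC -[leqRHS]addnA mul2n addnn.
Qed.

Lemma exchange_spec (S : {set E}) s y (v : E -> R) : is_base M S -> y \notin S ->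
  uniq s -> {subset s <= S} -> sorted (fun a b => v a <= v b) s ->
  let S' := run (exchange S s y) in
  [/\ S' \in M, #|S'| = #|S| &
      {in s, forall x, y |: S :\ x \in M -> exists z, [/\ z \in S, S' = y |: S :\ z & v x <= v z]}].
Proof.
move=> baseS yNS us sS sorts; have [SM _] := baseS.
rewrite /exchange (negPf yNS); set probe := fun k => ind _.
pose P k := y |: S :\: [set x in drop k s] \in M.
have probeP k : run (probe k) = P k by rewrite run_ind.
have Pdrop k x : x \in drop k s -> y |: S :\ x \in M -> P k.
  move=> xk /(indep_sub matM); apply; apply/setUS/setDS.
  by rewrite sub1set inE.
rewrite run_bind probeP; case: ifP => [P0|/negP P0]; last first.
  by split=> // x xs /(Pdrop 0%N); rewrite drop0 => /(_ xs).
have Pover k : (size s <= k)%N -> ~~ P k.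
  move=> sk; rewrite /P drop_oversize // (_ : [set x in [::]] = set0) ?setD0.
    exact: base_dep baseS yNS.
  by apply/setP => x; rewrite !inE.
rewrite run_bind /=.
have [|Pk Pk1] := @run_bsearch P probe fuel 0 probeP P0.
  apply: Pover; rewrite add0n; apply: leq_trans fuel_big.
  by rewrite -(card_uniqP us) max_card.
set k := run _ in Pk Pk1 *.
have ks : (k < size s)%N by rewrite ltnNge; apply: contraL Pk; apply: Pover.
have dropk : drop k s = nth y s k :: drop k.+1 s by apply: drop_nth.
have nS : nth y s k \in S by rewrite sS ?mem_nth.
split; last 1 first.
- move=> x xs xM; exists (nth y s k); split=> //.
  have : x \notin drop k.+1 s by apply: contra Pk1 => /Pdrop; apply.
  move: (xs); rewrite -{1}(cat_take_drop k.+1 s) mem_cat => /orP[xt _|->//].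
  rewrite -(nth_index y xs).
  apply: (sorted_leq_nth (leT := fun a b => v a <= v b)) => //.
  + by move=> b a c; apply: le_trans.
  + by rewrite inE index_mem.
  + by rewrite -ltnS -in_take.
- have [z []] := base_swap matM baseS yNS (subsetDl _ _ : S :\: [set x in drop k s] \subset S) Pk.
  rewrite !inE => /andP[]; rewrite negb_and negbK => /orP[|/negP//].
  rewrite dropk inE => /predU1P[->//|zk _ zM].
  by case/negP: Pk1; apply: Pdrop zM.
- by rewrite card_swap.
Qed.

Lemma step_spec X Y (S : {set E}) : is_base M S -> uniq X -> {subset X <= S} ->
  let S' := run (step X Y S) in
  [/\ is_base M S', g S <= g S' &
      forall x y, x \in X -> y \in Y -> y |: S :\ x \in M ->
        g (y |: S) - g S - (g S - g (S :\ x)) <= g S' - g S].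
Proof.
move=> baseS uX XS; have [SM _] := baseS.
rewrite /step run_bind run_mapM (eq_map (fun x => run_gval (S :\ x))).
set v := fun x => g (S :\ x).
have -> : zip X (map v X) = [seq (x, v x) | x <- X] by rewrite -{1}(map_id X) zip_map.
rewrite sort_map.
rewrite /unzip1 -map_comp map_id; set s := sort _ X.
have us : uniq s by rewrite sort_uniq.
have ss : s =i X by apply: mem_sort.
have sorts : sorted (fun a b => v a <= v b) s by apply: sort_sorted => a b; apply: le_total.
have sS : {subset s <= S} by move=> x; rewrite ss; apply: XS.
have better_ge A B : g A <= g (run (better gval A B)) /\ g B <= g (run (better gval A B)).
  by have := run_better_ge f I gval A B; rewrite /= !run_gval.
suff: let S' := run (best_exchange S s Y) in
  [/\ S' \in M, #|S'| = #|S|, g S <= g S' &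
      forall x y, x \in X -> y \in Y -> y |: S :\ x \in M ->
        g (y |: S) - g S - (g S - g (S :\ x)) <= g S' - g S].
  by move=> [S'M cS' gS gain]; split=> //; apply: base_card baseS S'M cS'.
elim: Y => [|y Y [BM cB gB gainB]] /=; first by split.
rewrite 2!run_bind; set B := run _ in BM cB gB gainB *.
have [AM cA gainA] : [/\ run (exchange S s y) \in M, #|run (exchange S s y)| = #|S| &
    {in X, forall x, y |: S :\ x \in M ->
      g (y |: S) - g S - (g S - g (S :\ x)) <= g (run (exchange S s y)) - g S}].
  have [yS|yNS] := boolP (y \in S).
    rewrite /exchange yS; split=> // x _ _; rewrite (setUidPr _) ?sub1set //=.
    by rewrite subrr sub0r oppr_le0 subr_ge0 mong ?subsetDl.
  have [AM cA gainA] := exchange_spec baseS yNS us sS sorts.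
  split=> // x xX; rewrite -ss in xX => /(gainA _ xX)[z [zS -> vxz]].
  by apply: le_trans (swap_gain_ge mong subg _ zS); move: vxz; rewrite /v; lra.
set A := run _ in AM cA gainA *; have [gA' gB'] := better_ge A B; split.
- exact: (@run_better_in _ _ _ _ _ (fun C : {set E} => C \in M)).
- exact: (@run_better_in _ _ _ _ _ (fun C : {set E} => #|C| = #|S|)).
- exact: le_trans gB'.
move=> x u xX; rewrite inE => /predU1P[->|uY] uM.
  by apply: le_trans (gainA _ xX uM) _; rewrite lerD2r.
by apply: le_trans (gainB _ _ xX uY uM) _; rewrite lerD2r.
Qed.

End LocalSearch.

Section Iteration.
Variables (R : realType) (N E W : finType).
Local Notation prog := (prog R N).
Variables (next : W -> {set E} -> prog {set E}) (value : {set E} -> prog R).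

Fixpoint iterate (ws : seq W) (S : {set E}) : prog {set E} :=
  if ws is w :: ws' then
    bind (next w S) (fun S' => bind (iterate ws' S') (better value S))
  else Ret S.

Variables (f : {set N} -> R) (I : {set {set N}}) (P : {set E} -> Prop).
Local Notation run := (run f I).
Local Notation cost := (cost f I).
Hypothesis next_inv : forall w S, P S -> P (run (next w S)).

Fixpoint visited_value (ws : seq W) (S : {set E}) : R :=
  if ws is w :: ws' then run (value S) + visited_value ws' (run (next w S)) else 0.

Lemma iterate_inv ws S : P S -> P (run (iterate ws S)).
Proof.
elim: ws S => //= w ws IH S PS; rewrite 2!run_bind.
by apply: run_better_in => //; apply/IH/next_inv.
Qed.

Lemma visited_value_le ws S : visited_value ws S <= (size ws)%:R * run (value (run (iterate ws S))).
Proof.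
elim: ws S => [|w ws IH] S /=; first by rewrite mul0r.
rewrite 2!run_bind; set B := run (iterate _ _).
have [geS geB] := run_better_ge f I value S B.
rewrite -natr1 mulrDl mul1r addrC lerD //.
by apply: le_trans (IH _) _; rewrite ler_wpM2l.
Qed.

Lemma cost_iterate c ws S : P S ->
  (forall w T, P T -> cost (next w T) <= c)%N -> (forall T, cost (value T) <= 1)%N ->
  (cost (iterate ws S) <= size ws * (c + 2))%N.
Proof.
move=> + next_c value_1; elim: ws S => //= w ws IH S PS.
rewrite 2!cost_bind cost_better mulSn -addnA leq_add ?next_c //.
by rewrite addnC (leq_add (leq_add (value_1 _) (value_1 _))) // IH //; apply: next_inv.
Qed.

(* The potential [g] is bounded, so on average the expected increase of [g] is small,
   and so is the gap to [c]. *)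
Lemma avgs_visited_ge (g : {set E} -> R) (c K B : R) k S : (0 < #|W|)%N -> 0 <= K ->
  (forall S, P S -> g S <= B) ->
  (forall S, P S -> c <= run (value S) + K * (avg (fun w => g (run (next w S))) - g S)) ->
  P S -> k%:R * c <= avgs k (fun ws => visited_value ws S) + K * (B - g S).
Proof.
move=> W0 K0 gB gain; elim: k S => [|k IH] S PS /=.
  by rewrite mul0r add0r mulr_ge0 // subr_ge0 gB.
have : avg (fun w => k%:R * c - K * B + run (value S) + K * g (run (next w S))) <=
    avg (fun w => avgs k (fun ws => run (value S) + visited_value ws (run (next w S)))).
  apply: ler_avg => w; rewrite avgsD avgs_const //.
  by have := IH _ (next_inv w PS); lra.
rewrite avgD avg_const // avgZ -natr1; have := gain S PS; lra.
Qed.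

End Iteration.

(** * Full and sampled steps *)

(* Bounded below by 1 so that bounds remain meaningful for a matroid of rank 0. *)
Definition rank1 (E : finType) (S : {set E}) := maxn #|S| 1.

Section Samplers.
Variables (R : realType) (N E : finType).
Variables (gval : {set E} -> prog R N R) (ind : {set E} -> prog R N bool) (fuel : nat).
Variables (f : {set N} -> R) (I : {set {set N}}).
Variables (M : {set {set E}}) (g : {set E} -> R).
Hypotheses (matM : matroid M) (mong : monotone g) (subg : submodular g).
Hypotheses (run_gval : forall S, run f I (gval S) = g S).
Hypotheses (run_ind : forall S, run f I (ind S) = (S \in M)).
Hypothesis fuel_big : (#|E| <= 2 ^ fuel)%N.
Local Notation result X Y S := (run f I (step gval ind fuel X Y S)).

Implicit Types S V : {set E}.

Lemma exchange_gain (S V : {set E}) : is_base M S -> V \in M ->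
  exists h : E -> E, [/\ {in V &, injective h}, {in V, forall u, h u \in S},
    {in V, forall u, u |: S :\ h u \in M} &
    \sum_(u in V) (g (u |: S) - g S) - \sum_(x in S) (g S - g (S :\ x)) <=
    \sum_(u in V) (g (u |: S) - g S - (g S - g (S :\ h u)))].
Proof.
move=> baseS VM; have [h [injh hS hM _]] := exchange_injection matM baseS VM.
exists h; split=> //; rewrite [leRHS]sumrB lerD2l lerN2.
rewrite -(big_imset (fun x => g S - g (S :\ x)) injh) /=.
rewrite [leRHS](big_setID (h @: V)) /= (setIidPr _).
  by rewrite lerDl sumr_ge0 // => x _; rewrite subr_ge0 mong ?subsetDl.
by apply/subsetP => _ /imsetP[u uV ->]; apply: hS.
Qed.

Lemma full_gain (S V : {set E}) : is_base M S -> V \in M ->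
  \sum_(u in V) (g (u |: S) - g S) - \sum_(x in S) (g S - g (S :\ x)) <=
  (rank1 S)%:R * (g (result (enum S) (enum E) S) - g S).
Proof.
move=> baseS VM; have [h [_ hS hM]] := exchange_gain baseS VM.
have XS : {subset enum S <= S} by move=> x; rewrite mem_enum.
have [_ gS gain] :=
  step_spec matM mong subg run_gval run_ind fuel_big (enum E) baseS (enum_uniq _) XS.
move/le_trans; apply; set G := _ - g S in gain *.
apply: le_trans (_ : \sum_(u in V) G <= _).
  by apply: ler_sum => u uV; apply: gain; rewrite ?mem_enum ?hS ?hM.
rewrite sumr_const -[leLHS]mulr_natl ler_wpM2r ?subr_ge0 // ler_nat leq_max.
by case: baseS => _ /(_ V VM) ->.
Qed.

Lemma draws_gain (S V : {set E}) (h : E -> E) (X : seq E) (a m : nat) :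
  is_base M S -> uniq X -> {subset X <= S} ->
  {in V &, injective h} -> {in V, forall u, u |: S :\ h u \in M} ->
  (0 < #|E|)%N -> (a <= m)%N -> (2 * a.-1 * size X <= #|E|)%N ->
  a%:R / 2 * avg (fun u => if (u \in V) && (h u \in X)
                           then Num.max 0 (g (u |: S) - g S - (g S - g (S :\ h u))) else 0)
  <= avg (fun ys : m.-tuple E => g (result X (take a ys) S) - g S).
Proof.
move=> baseS uX XS injh hM E0 am sparse; set z := fun u => if _ then _ else _.
rewrite (avg_tuple m (fun ys => g (result X (take a ys) S) - g S)).
rewrite (avgs_take E0 (fun ys => g (result X ys S) - g S)) //.
apply: le_trans (_ : avgs a (fun ys => \big[Num.max/0]_(u <- ys) z u) <= _); last first.
  apply: ler_avgs => Y _.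
  have [_ gS gain] := step_spec matM mong subg run_gval run_ind fuel_big Y baseS uX XS.
  rewrite big_seq; apply: bigmax_le => [|u uY]; first by rewrite subr_ge0.
  rewrite /z; case: ifP => [/andP[uV hX]|_]; last by rewrite subr_ge0.
  by rewrite ge_max subr_ge0 gS gain ?hM.
apply: (avgs_max_ge E0 (A := [set u in V | h u \in X])).
- by move=> u; rewrite /z; case: ifP => // _; rewrite le_max lexx.
- by move=> u; rewrite inE /z => /negPf ->.
apply: leq_trans sparse; rewrite leq_mul2l; apply/orP; right.
rewrite -(card_in_imset (f := h)) => [|u v]; last first.
  by rewrite !inE => /andP[uV _] /andP[vV _]; apply: injh.
rewrite -(card_uniqP uX); apply/subset_leq_card/subsetP => x /imsetP[u].
by rewrite inE => /andP[_ hX] ->.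
Qed.

Variable width : nat.

Definition block_size (S : {set E}) := minn (rank1 S) width.
Definition block_num (S : {set E}) := (rank1 S %/ block_size S).+1.
Definition draw_num (S : {set E}) := (#|E| %/ (2 * block_size S)).+1.
Definition block (S : {set E}) i := take (block_size S) (drop (i * block_size S) (enum S)).

(* The number of blocks depends on the unknown rank, but it divides [(#|E| + 1)!], so
   that the residue of the first component is a uniform block index. *)
Definition sample_seed := ('I_(#|E|.+1)`! * #|E|.+1.-tuple E)%type.

Definition sample_step (w : sample_seed) (S : {set E}) :=
  step gval ind fuel (block S (w.1 %% block_num S)) (take (draw_num S) w.2) S.

Hypotheses (width_gt0 : (0 < width)%N) (E_gt0 : (0 < #|E|)%N).

Lemma block_size_gt0 S : (0 < block_size S)%N.
Proof. by rewrite leq_min width_gt0 leq_max orbT. Qed.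

Lemma block_uniq S i : uniq (block S i).
Proof. by rewrite take_uniq // drop_uniq // enum_uniq. Qed.

Lemma block_sub S i : {subset block S i <= S}.
Proof. by move=> x /mem_take /mem_drop; rewrite mem_enum. Qed.

Lemma size_block S i : (size (block S i) <= block_size S)%N.
Proof. by rewrite size_take; case: ltnP. Qed.

Lemma block_cover S x : x \in S -> exists i : 'I_(block_num S), x \in block S i.
Proof.
rewrite -mem_enum => xS; set p := index x (enum S).
have b0 := block_size_gt0 S.
have pS : (p < #|S|)%N by rewrite cardE index_mem.
have lt_i : (p %/ block_size S < block_num S)%N.
  by rewrite ltnS leq_div2r // (leq_trans (ltnW pS)) // leq_max leqnn.
exists (Ordinal lt_i); rewrite /block /=.
rewrite -(nth_index x xS) -/p {1}(divn_eq p (block_size S)) -nth_drop.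
rewrite -(nth_take x (ltn_pmod p b0)) mem_nth // size_take size_drop -cardE.
have := ltn_pmod p b0; have := divn_eq p (block_size S); case: ifP => // _; lia.
Qed.

Lemma sample_gain (S V : {set E}) : is_base M S -> V \in M ->
  \sum_(u in V) (g (u |: S) - g S) - \sum_(x in S) (g S - g (S :\ x)) <=
  8 * (rank1 S)%:R * (avg (fun w => g (run f I (sample_step w S))) - g S).
Proof.
move=> baseS VM; have [h [injh hS hM]] := exchange_gain baseS VM.
move/le_trans; apply.
pose z u := Num.max 0 (g (u |: S) - g S - (g S - g (S :\ h u))).
apply: le_trans (_ : \sum_(u in V) z u <= _).
  by apply: ler_sum => u _; rewrite le_max lexx orbT.
have z0 u : 0 <= z u by rewrite le_max lexx.
have b0 := block_size_gt0 S.
set b := block_size S in b0; pose d := block_num S; pose a := draw_num S.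
have rE : (rank1 S <= #|E|)%N by rewrite geq_max max_card.
have fact0 : (0 < #|E|.+1`!)%N by apply: fact_gt0.
have d_fact : (d %| #|E|.+1`!)%N.
  by apply: dvdn_fact; rewrite /= /d /block_num ltnS; apply: leq_trans (leq_div _ _) rE.
have Dgain : avg (fun w => g (run f I (sample_step w S))) - g S =
  avg (fun i : 'I_d => avg (fun ys : #|E|.+1.-tuple E =>
    g (result (block S i) (take a ys) S) - g S)).
  rewrite -(avg_modn (fun i => avg (fun ys : #|E|.+1.-tuple E =>
     g (result (block S i) (take a ys) S) - g S)) (ltn0Sn _) fact0 d_fact).
  rewrite -(avg_pair (fun (s : 'I_(#|E|.+1)`!) (ys : #|E|.+1.-tuple E) =>
     g (result (block S (s %% d)) (take a ys) S) - g S)).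
  by rewrite avgD avg_const // card_prod card_ord card_tuple muln_gt0 fact0 expn_gt0 E_gt0.
pose zX i u := if (u \in V) && (h u \in block S i) then z u else 0.
have gain : avg (fun i : 'I_d => a%:R / 2 * avg (zX i)) <=
    avg (fun w => g (run f I (sample_step w S))) - g S.
  rewrite Dgain; apply: ler_avg => i; apply: draws_gain => //.
  - exact: block_uniq.
  - exact: block_sub.
  - by rewrite ltnS leq_div.
  rewrite /a /draw_num /=; apply: leq_trans (leq_trunc_div #|E| (2 * b)).
  by rewrite mulnAC mulnC leq_mul2l leq_mul2l size_block !orbT.
apply: le_trans (ler_wpM2l _ gain); last by rewrite mulr_ge0 ?ler0n.
rewrite avgZ {gain Dgain}.
have cover : (\sum_(u in V) z u) / #|E|%:R <= d%:R * avg (fun i : 'I_d => avg (zX i)).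
  rewrite /avg card_ord [leRHS]mulrC divfK ?pnatr_eq0 //.
  rewrite -mulr_suml ler_wpM2r ?invr_ge0 // exchange_big /= [leLHS]big_mkcond /=.
  apply: ler_sum => u _; case: ifP => uV; last by apply: sumr_ge0 => i _; rewrite /zX uV.
  have [i hi] := block_cover (hS u uV).
  rewrite (bigD1 i) //= {1}/zX uV hi /= lerDl sumr_ge0 // => j _.
  by rewrite /zX; case: ifP.
move: cover; set Z := \sum_(u in V) z u; set q := avg _.
have n0 : 0 < #|E|%:R :> R by rewrite ltr0n.
rewrite ler_pdivrMr // => cover.
have Z0 : 0 <= Z by apply: sumr_ge0.
have q0 : 0 <= q.
  rewrite divr_ge0 // sumr_ge0 // => i _; rewrite divr_ge0 // sumr_ge0 // => u _.
  by rewrite /zX; case: ifP.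
apply: le_trans cover _.
have -> : 8 * (rank1 S)%:R * (a%:R / 2 * q) = 4 * (rank1 S)%:R * a%:R * q by field.
rewrite mulrAC ler_wpM2r // -!natrM ler_nat.
have b_le : (b <= rank1 S)%N by apply: geq_minl.
have db : (d * b <= 2 * rank1 S)%N.
  by rewrite /d /block_num [leqLHS]mulSn mul2n -addnn leq_add // leq_trunc_div.
have ab : (#|E| <= a * (2 * b))%N.
  by rewrite ltnW // -ltn_divLR // muln_gt0.
rewrite -(leq_pmul2r b0).
apply: leq_trans (_ : d * b * (a * (2 * b)) <= _)%N; first by rewrite mulnAC leq_mul2l ab orbT.
apply: leq_trans (_ : 2 * rank1 S * (a * (2 * b)) <= _)%N; first by rewrite leq_mul2r db orbT.
by apply: eq_leq; ring.
Qed.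

End Samplers.

(** * The algorithms *)

Section LiftedMatroid.
Variables (N : finType) (l : nat) (I : {set {set N}}).
Hypothesis matI : matroid I.
Local Notation E := (N * 'I_l.+1)%type.

Definition uncolor (S : {set E}) : {set N} := [set e.1 | e in S].

Definition color_with (B : {set N}) j : {set E} := [set (v, j) | v in B].

Definition lift_matroid : {set {set E}} :=
  [set S : {set E} | (#|uncolor S| == #|S|) && (uncolor S \in I)].

Lemma uncolor_color_with B j : uncolor (color_with B j) = B.
Proof. by rewrite /uncolor -imset_comp imset_id. Qed.

Lemma card_color_with B j : #|color_with B j| = #|B|.
Proof. by rewrite card_imset // => u v []. Qed.

Lemma color_with_lift B j : (color_with B j \in lift_matroid) = (B \in I).
Proof. by rewrite inE uncolor_color_with card_color_with eqxx. Qed.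

Lemma lift_matroidP : matroid lift_matroid.
Proof.
split.
- by apply/set0Pn; exists (color_with set0 ord0); rewrite color_with_lift indep0.
- move=> S T; rewrite !inE => /andP[/imset_injP injT TI] sST; apply/andP; split.
    by apply/imset_injP => x y xS yS; apply: injT; apply: (subsetP sST).
  by apply: (indep_sub matI TI); apply: imsetS.
- move=> S T; rewrite !inE => /andP[/eqP cS SI] /andP[/eqP cT TI].
  rewrite -cS -cT => lt; have [_ _ /(_ _ _ SI TI lt)[v]] := matI.
  rewrite inE => /andP[vNS /imsetP[e eT ve]] vI.
  have eNS : e \notin S by apply: contra vNS => eS; rewrite ve imset_f.
  exists e; first by rewrite inE eNS.
  rewrite inE /uncolor imsetU1 -/(uncolor S) -ve vI andbT.
  by rewrite !cardsU1 vNS eNS cS.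
Qed.

Lemma color_with_base B j : is_base I B -> is_base lift_matroid (color_with B j).
Proof.
case=> BI maxB; split=> [|T]; first by rewrite color_with_lift.
by rewrite inE card_color_with => /andP[/eqP <- /maxB].
Qed.

End LiftedMatroid.

Section Solver.
Variables (R : realType) (N : finType) (l : nat).
Local Notation L := l.+1.
Local Notation E := (N * 'I_L)%type.
Local Notation prog := (prog R N).

Definition query_part (J : {set 'I_L}) (S : {set E}) : prog R :=
  Value (part J S) (fun v => Ret (weight R l #|J| * v)).

Definition query_potential (S : {set E}) : prog R :=
  bind (mapM (fun J => query_part J S) (enum {set 'I_L})) (fun vals => Ret (\sum_(v <- vals) v)).

Definition query_lift (S : {set E}) : prog bool :=
  if #|uncolor S| == #|S| then @Indep R N bool (uncolor S) (fun b => Ret b) else Ret false.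

Definition query_value (S : {set E}) : prog R := @Value R N R (uncolor S) (fun v => Ret v).

Fixpoint greedy (s : seq N) (B : {set N}) : prog {set N} :=
  if s is v :: s' then
    @Indep R N _ (v |: B) (fun b => greedy s' (if b then v |: B else B))
  else Ret B.

Definition solve (W : finType) (next : W -> {set E} -> prog {set E}) (K : nat) (ws : seq W) :
    prog {set N} :=
  bind (greedy (enum N) set0) (fun B =>
    bind (iterate next query_value (take (K * rank1 B) ws) (color_with B ord0))
      (fun S => Ret (uncolor S))).

Variables (f : {set N} -> R) (I : {set {set N}}).
Hypothesis instfI : instance f I.
Local Notation run := (run f I).
Local Notation cost := (cost f I).
Local Notation M := (lift_matroid l I).
Local Notation g := (@potential R N l f).

Let f0 : nonnegative f. Proof. by case: instfI. Qed.
Let monf : monotone f. Proof. by case: instfI. Qed.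
Let subf : submodular f. Proof. by case: instfI. Qed.
Let matI : matroid I. Proof. by case: instfI. Qed.

Lemma run_query_potential S : run (query_potential S) = g S.
Proof. by rewrite /query_potential run_bind /= run_mapM big_map big_enum. Qed.

Lemma cost_query_potential S : cost (query_potential S) = (2 ^ L)%N.
Proof.
rewrite /query_potential cost_bind addn0 (cost_mapM _ (m := 1)) // muln1.
by rewrite -cardE -cardsT -powersetT card_powerset cardsT card_ord.
Qed.

Lemma run_query_lift S : run (query_lift S) = (S \in M).
Proof. by rewrite /query_lift inE; case: ifP. Qed.

Lemma cost_query_lift S : (cost (query_lift S) <= 1)%N.
Proof. by rewrite /query_lift; case: ifP. Qed.

Lemma cost_greedy s B : cost (greedy s B) = size s.
Proof. by elim: s B => //= v s IH B; rewrite IH. Qed.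

Lemma greedy_spec s (B : {set N}) : B \in I ->
  let B' := run (greedy s B) in
  [/\ B' \in I, B \subset B' & {in s, forall v, v \notin B' -> v |: B' \notin I}].
Proof.
elim: s B => [|v s IH] B BI; first by split.
rewrite /=; case: ifP => [vBI|/negbT vBI].
  have [B'I sB' max'] := IH _ vBI; split=> //; first exact: subset_trans (subsetUr _ _) sB'.
  move=> u; rewrite inE => /predU1P[->|us]; last exact: max'.
  by rewrite (subsetP sB') ?setU11.
have [B'I sB' max'] := IH _ BI; split=> // u; rewrite inE => /predU1P[->|us]; last exact: max'.
by move=> _; apply: contra vBI => /(indep_sub matI); apply; apply: setUS.
Qed.

Lemma greedy_base : is_base I (run (greedy (enum N) set0)).
Proof.
have [BI _ maxB] := greedy_spec (enum N) (indep0 matI); split=> // T TI.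
rewrite leqNgt; apply/negP => lt; have [_ _ /(_ _ _ BI TI lt)[v]] := matI.
by rewrite inE => /andP[vNB _]; apply/negP/maxB; rewrite ?mem_enum.
Qed.

Lemma base_rank B : is_base I B -> matroid_rank I = #|B|.
Proof.
case=> BI maxB; apply/eqP; rewrite eqn_leq; apply/andP; split.
  by apply/bigmax_leqP => T; apply: maxB.
exact: (leq_bigmax_cond (F := fun S : {set N} => #|S|)).
Qed.

Lemma lift_base_rank S : is_base M S -> rank1 S = maxn (matroid_rank I) 1.
Proof.
move=> [SM maxS]; rewrite (base_rank greedy_base) /rank1; congr maxn.
have [BM maxB] := color_with_base (@ord0 l) greedy_base.
apply/eqP; rewrite eqn_leq -[X in (_ <= X)%N && (X <= _)%N](card_color_with _ (@ord0 l)).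
by rewrite maxB // maxS.
Qed.

Lemma opt_attained : exists2 T, T \in I & opt f I = f T /\ forall S, S \in I -> f S <= f T.
Proof.
have [T TI maxT] := arg_maxP f (indep0 matI); exists T => //; split=> //.
apply/le_anti/andP; split; first by apply: bigmax_le => // S SI; apply: maxT.
exact: le_bigmax_cond TI.
Qed.

Section Guarantee.
Variables (W : finType) (next : W -> {set E} -> prog {set E}).
Hypothesis W_gt0 : (0 < #|W|)%N.
Hypothesis next_base : forall w S, is_base M S -> is_base M (run (next w S)).

Lemma solve_indep K ws : run (solve next K ws) \in I.
Proof.
rewrite /solve run_bind run_bind /=; set S := run _.
have [] : is_base M S by apply: (iterate_inv _ next_base); apply/color_with_base/greedy_base.
by rewrite inE => /andP[].
Qed.

Lemma cost_solve K ws c : (forall w S, is_base M S -> cost (next w S) <= c)%N ->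
  (cost (solve next K ws) <= #|N| + K * maxn (matroid_rank I) 1 * (c + 2))%N.
Proof.
move=> next_c; have B := greedy_base; rewrite /solve cost_bind cost_greedy -cardE leq_add2l.
set B0 := run _ in B *; rewrite cost_bind addn0.
apply: leq_trans (cost_iterate next_base _ (color_with_base _ B) next_c _) _ => //.
by rewrite leq_mul2r size_take_min (base_rank B) geq_minl orbT.
Qed.

Definition total_weight : R := \sum_(J : {set 'I_L}) weight R l #|J|.

Lemma potential_le S T : (forall S, S \in I -> f S <= f T) -> S \in M -> g S <= total_weight * f T.
Proof.
move=> maxT; rewrite inE => /andP[_ SI]; rewrite mulr_suml; apply: ler_sum => J _.
apply: ler_wpM2l (weight_ge0 _ _ _) _ _ _; apply/maxT/(indep_sub matI SI).
by apply/subsetP => v /in_part[j _ vj]; apply/imsetP; exists (v, j).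
Qed.

Lemma solve_guarantee K m : (0 < K)%N -> (K * maxn (matroid_rank I) 1 <= m)%N ->
  (forall S V, is_base M S -> V \in M ->
    \sum_(u in V) (g (u |: S) - g S) - \sum_(x in S) (g S - g (S :\ x)) <=
    8 * (rank1 S)%:R * (avg (fun w => g (run (next w S))) - g S)) ->
  (1 - growth R l ^- L - 8 * total_weight / K%:R) * opt f I <=
  avgs m (fun ws => f (run (solve next K ws))).
Proof.
move=> K0 Km gain; have [T TI [-> maxT]] := opt_attained.
set r := maxn _ _ in Km *; pose q : R := growth R l.
have q1 : 1 <= q by rewrite lerDl invr_ge0.
have L1 : 1 <= L%:R :> R by rewrite ler1n.
pose D : R := L%:R ^+ 2 * q ^+ L.
have LD : L%:R <= D.
  apply: le_trans (_ : L%:R * L%:R <= _); first by rewrite ler_peMr // (le_trans ler01).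
  by rewrite /D expr2 ler_peMr ?exprn_ege1 ?mulr_ge0.
have D0 : 0 < D by apply: lt_le_trans LD; rewrite ltr0n.
have qL0 : q ^+ L != 0 by rewrite expf_neq0 // gt_eqF // (lt_le_trans ltr01).
pose c := (1 - q ^- L) * f T.
pose C : R := L%:R / D * (8 * r%:R).
have LD1 : 0 <= L%:R / D <= 1 by rewrite divr_ge0 ?(ltW D0) //= ler_pdivrMr // mul1r.
have C0 : 0 <= C by apply: mulr_ge0; [case/andP: LD1 | rewrite mulr_ge0].
have step_gain S : is_base M S ->
    c <= run (query_value S) + C * (avg (fun w => g (run (next w S))) - g S).
  move=> baseS; set G := avg _ - _.
  have := local_search_bound f0 monf subf S T; rewrite -/q.
  rewrite -/D => bound.
  have {}bound : L%:R ^+ 2 * (q ^+ L - 1) * f T <= D * f (uncolor S) + L%:R * (8 * r%:R * G).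
    apply: (le_trans bound); rewrite lerD2l.
    apply: le_trans (_ : \sum_(j < L) (8 * r%:R * G) <= _); last first.
      by rewrite sumr_const card_ord -[leLHS]mulr_natl.
    apply: ler_sum => j _.
    have := gain S (color_with T j) baseS; rewrite color_with_lift => /(_ TI).
    by rewrite big_imset /= ?(lift_base_rank baseS) // => u v _ _ [].
  rewrite -(ler_pM2l D0) mulrDr /c /C.
  have -> : D * ((1 - q ^- L) * f T) = L%:R ^+ 2 * (q ^+ L - 1) * f T.
    by rewrite /D; field.
  have -> : D * (L%:R / D * (8 * r%:R) * G) = L%:R * (8 * r%:R * G).
    by field; rewrite gt_eqF.
  exact: bound.
have baseB := greedy_base; set B := run _ in baseB.
have base0 := color_with_base (@ord0 l) baseB.
pose k := (K * r)%N.
have k0 : 0 < k%:R :> R by rewrite ltr0n muln_gt0 K0 leq_max orbT.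
have avgE : avgs m (fun ws => f (run (solve next K ws))) =
    avgs k (fun ws => f (uncolor (run (iterate next query_value ws (color_with B ord0))))).
  rewrite -(avgs_take W_gt0 _ Km); apply: eq_avgs => ws.
  by rewrite /solve run_bind run_bind /rank1 -(base_rank baseB).
rewrite avgE -(ler_pM2l k0).
have := @avgs_visited_ge _ _ _ W next query_value f I (is_base M) next_base g c C
  (total_weight * f T) k (color_with B ord0) W_gt0 C0 _ step_gain base0.
have gB S : is_base M S -> g S <= total_weight * f T by case=> SM _; apply: potential_le.
move=> /(_ gB); rewrite -avgsZ => total_ge.
have totle : avgs k (fun ws => visited_value next query_value f I ws (color_with B ord0)) <=
    avgs k (fun ws => k%:R * f (uncolor (run (iterate next query_value ws (color_with B ord0))))).
  apply: ler_avgs => ws szk; have := visited_value_le next query_value f I ws (color_with B ord0).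
  by rewrite szk.
refine (le_trans _ totle).
have g0 : 0 <= g (color_with B ord0) by apply: potential_ge0.
have w0 : 0 <= total_weight * f T by apply: le_trans g0 (gB _ base0).
have Cle : C * (total_weight * f T - g (color_with B ord0)) <= 8 * r%:R * (total_weight * f T).
  apply: le_trans (_ : C * (total_weight * f T) <= _); first by rewrite ler_wpM2l // lerBlDr lerDl.
  rewrite ler_wpM2r // /C mulrC ler_piMr ?mulr_ge0 //.
  by case/andP: LD1.
have -> : k%:R * ((1 - growth R l ^- L - 8 * total_weight / K%:R) * f T) =
    k%:R * c - 8 * r%:R * (total_weight * f T).
  by rewrite /k /c natrM -/q; field; rewrite qL0 pnatr_eq0 -lt0n.
by rewrite lerBlDr; apply: le_trans total_ge _; rewrite lerD2l.
Qed.

End Guarantee.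

End Solver.

Section UniformAlgorithm.
Variables (R : realType) (N W : finType).
Hypothesis W_gt0 : (0 < #|W|)%N.

Lemma uniform_ge0 (w : W) : 0 <= #|W|%:R^-1 :> R.
Proof. by rewrite invr_ge0. Qed.

Lemma uniform_sum1 : \sum_(w : W) #|W|%:R^-1 = 1 :> R.
Proof. by rewrite sumr_const -[LHS]mulr_natr mulVf // pnatr_eq0 -lt0n. Qed.

Definition uniform_alg (A : W -> query_alg R N) : rand_query_alg R N :=
  RandQueryAlg uniform_ge0 uniform_sum1 A.

Lemma expected_uniform f I A :
  expected_value f I (uniform_alg A) = avg (fun w => f (output f I (A w))).
Proof. by rewrite /expected_value /= -mulr_sumr mulrC. Qed.

End UniformAlgorithm.

Section Numerics.
Variable R : realType.

Lemma growth_inv_le l : growth R l ^- l.+1 <= (expR 1)^-1 + l.+1%:R^-1.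
Proof.
set L : R := l.+1%:R; have L0 : 0 < L by rewrite ltr0n.
have q0 : 0 < growth R l := growth_gt0 R l.
have L1 : 0 < L + 1 by rewrite addr_gt0.
have qV : (growth R l)^-1 = 1 - (L + 1)^-1.
  rewrite /growth -/L; have -> : 1 + L^-1 = (L + 1) / L by rewrite mulrDl mulfV ?mul1r // gt_eqF.
  by rewrite invf_div -{1}[L](addrK 1) mulrBl mulfV ?mul1r // gt_eqF.
have leV : (growth R l)^-1 <= expR (- (L + 1)^-1) by rewrite qV expR_ge1Dx.
have powV : (growth R l)^-1 ^+ l.+2 <= (expR 1)^-1.
  rewrite -expRN; have -> : -1 = l.+2%:R * - (L + 1)^-1 :> R.
    by rewrite /L natr1 mulrN mulfV ?pnatr_eq0.
  by rewrite expRM_natl lerXn2r // nnegrE ?expR_ge0 ?invr_ge0 ?ltW.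
have -> : growth R l ^- l.+1 = (growth R l)^-1 ^+ l.+2 * growth R l.
  by rewrite [in RHS]exprSr mulfVK ?gt_eqF // exprVn.
apply: le_trans (_ : (expR 1)^-1 * growth R l <= _); first by rewrite ler_wpM2r // ltW.
rewrite /growth mulrDr mulr1 lerD2l ler_piMl ?invr_ge0 //.
by rewrite invf_le1 ?expR_gt0 // ltW // expR_gt1.
Qed.

Lemma ln2_ge : 2^-1 <= ln 2 :> R.
Proof.
have : ln (1 + - 2^-1) <= - 2^-1 :> R by apply: le_ln1Dx; lra.
have -> : 1 + - 2^-1 = 2^-1 :> R by field.
by rewrite lnV ?lerN2 // posrE.
Qed.

Lemma trunc_log_le_ln n : (0 < n)%N -> (trunc_log 2 n)%:R <= 2 * ln n%:R :> R.
Proof.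
move=> n0; have le2t : (2 ^ trunc_log 2 n <= n)%N by apply: trunc_logP.
have : ln (2 ^+ trunc_log 2 n) <= ln n%:R :> R.
  by rewrite ler_ln ?posrE ?exprn_gt0 ?ltr0n // -natrX ler_nat.
rewrite lnXn // -[leLHS]mulr_natl => le_ln.
have : (trunc_log 2 n)%:R * 2^-1 <= (trunc_log 2 n)%:R * ln 2 :> R.
  by rewrite ler_wpM2l ?ln2_ge.
lra.
Qed.

Lemma query_bound (P lam n K r x y G fuel cF A B : R) :
  0 <= n -> 0 <= K -> 0 <= r -> 0 <= x -> 0 <= y -> 0 <= G -> 0 <= fuel -> 1 <= lam ->
  n <= P -> r <= P -> r * x <= A * P -> r * y <= B * P -> fuel <= cF * lam ->
  n + K * r * (x * G + y * (fuel + 2 * G) + 2) <=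
  (1 + K * (A * G + B * (cF + 2 * G) + 2)) * lam * P.
Proof.
move=> n0 K0 r0 x0 y0 G0 F0 lam1 nP rP rxP ryP FF.
have P0 : 0 <= P by apply: le_trans nP.
have lam0 : 0 <= lam by apply: le_trans lam1.
have le_lam z : 0 <= z -> z <= lam * z by move=> z0; rewrite ler_peMl.
have h1 : n <= lam * P by apply: le_trans nP (le_lam _ P0).
have h2 : r * x * G <= lam * (A * P * G).
  apply: le_trans (_ : A * P * G <= _); first by rewrite ler_wpM2r.
  by apply: le_lam; rewrite mulr_ge0 // (le_trans _ rxP) ?mulr_ge0.
have BP0 : 0 <= B * P by apply: le_trans ryP; rewrite mulr_ge0.
have h3 : r * y * (fuel + 2 * G) <= B * P * (lam * (cF + 2 * G)).
  apply: ler_pM => //; rewrite ?mulr_ge0 ?addr_ge0 ?mulr_ge0 //.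
  rewrite mulrDr lerD //; first by rewrite mulrC.
  by apply: le_lam; rewrite mulr_ge0.
have h4 : r <= lam * P by apply: le_trans rP (le_lam _ P0).
have : K * (r * x * G + r * y * (fuel + 2 * G) + 2 * r) <=
    K * (lam * (A * P * G) + B * P * (lam * (cF + 2 * G)) + 2 * (lam * P)).
  by rewrite ler_wpM2l // !lerD // ler_wpM2l.
lra.
Qed.

End Numerics.

Section Algorithms.
Variables (R : realType) (N : finType) (l : nat).
Local Notation L := l.+1.
Local Notation E := (N * 'I_L)%type.

Definition search_depth := (trunc_log 2 #|{: E}|).+1.

Definition full_step (_ : unit) (S : {set E}) : prog R N {set E} :=
  step (@query_potential R N l) (@query_lift R N l) search_depth (enum S) (enum {: E}) S.

Definition sqrt_width := (Num.truncn (Num.sqrt (#|N|%:R : R))).+1.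

Definition sampled_step : sample_seed E -> {set E} -> prog R N {set E} :=
  sample_step (@query_potential R N l) (@query_lift R N l) search_depth sqrt_width.

Lemma card_lifted : #|{: E}| = (#|N| * L)%N.
Proof. by rewrite card_prod card_ord. Qed.

Lemma search_depth_ge : (#|{: E}| <= 2 ^ search_depth)%N.
Proof. by rewrite ltnW // trunc_log_ltn. Qed.

Lemma search_depth_le : (0 < #|N|)%N ->
  search_depth.+1%:R <= (2 + 2 * ln L%:R) * (1 + ln #|N|%:R) :> R.
Proof.
move=> n0; have nL0 : (0 < #|{: E}|)%N by rewrite card_lifted muln_gt0 n0.
have := trunc_log_le_ln R nL0; rewrite card_lifted natrM lnM ?posrE ?ltr0n // => le_t.
have lnn : 0 <= ln #|N|%:R :> R by rewrite ln_ge0 // ler1n.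
have lnL : 0 <= ln L%:R :> R by rewrite ln_ge0 // ler1n.
have := mulr_ge0 lnn lnL.
rewrite /search_depth card_lifted -addn2 natrD; lra.
Qed.

Variables (f : {set N} -> R) (I : {set {set N}}).
Hypothesis instfI : instance f I.
Local Notation run := (run f I).
Local Notation cost := (cost f I).
Local Notation M := (lift_matroid l I).
Local Notation g := (@potential R N l f).
Local Notation r1 := (maxn (matroid_rank I) 1).

Let matI : matroid I. Proof. by case: instfI. Qed.
Let matM : matroid M. Proof. exact: lift_matroidP. Qed.
Let mong : monotone g. Proof. by case: instfI => _ monf _ _; apply: potential_monotone. Qed.
Let subg : submodular g. Proof. by case: instfI => _ monf subf _; apply: potential_submodular. Qed.

Lemma full_step_base w S : is_base M S -> is_base M (run (full_step w S)).
Proof.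
move=> baseS; have XS : {subset enum S <= S} by move=> x; rewrite mem_enum.
by have [] := step_spec matM mong subg (run_query_potential f I) (run_query_lift f I)
  search_depth_ge (enum {: E}) baseS (enum_uniq _) XS.
Qed.

Lemma sampled_step_base w S : is_base M S -> is_base M (run (sampled_step w S)).
Proof.
move=> baseS; rewrite /sampled_step /sample_step.
by have [] := step_spec matM mong subg (run_query_potential f I) (run_query_lift f I)
  search_depth_ge (take (draw_num sqrt_width S) w.2) baseS (block_uniq sqrt_width S _)
  (@block_sub _ sqrt_width S (w.1 %% block_num sqrt_width S)).
Qed.

Lemma rank_le_card : (matroid_rank I <= #|N|)%N.
Proof. by apply/bigmax_leqP => S _; apply: max_card. Qed.

Lemma cost_full_step w S : is_base M S ->
  (cost (full_step w S) <= matroid_rank I * 2 ^ L + #|N| * L * (search_depth.+1 + 2 * 2 ^ L))%N.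
Proof.
move=> [SM _]; have := cost_step search_depth (cost_query_potential f I) (cost_query_lift f I)
  (enum S) (enum {: E}) S.
move/leq_trans; apply; rewrite -!cardE card_lifted leq_add2r leq_mul2r; apply/orP; right.
move: SM; rewrite inE => /andP[/eqP <- SI].
exact: (leq_bigmax_cond (F := fun S : {set N} => #|S|)).
Qed.

Definition sample_width := minn r1 sqrt_width.

Lemma cost_sampled_step w S : is_base M S ->
  (cost (sampled_step w S) <= sample_width * 2 ^ L +
    (#|N| * L %/ (2 * sample_width)).+1 * (search_depth.+1 + 2 * 2 ^ L))%N.
Proof.
move=> baseS; have := cost_step search_depth (cost_query_potential f I) (cost_query_lift f I)
  (block sqrt_width S (w.1 %% block_num sqrt_width S)) (take (draw_num sqrt_width S) w.2) S.
move/leq_trans; apply.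
have widthE : block_size sqrt_width S = sample_width.
  by rewrite /block_size (lift_base_rank instfI baseS).
apply: leq_add; rewrite leq_mul2r; apply/orP; right.
  by rewrite -widthE size_block.
by rewrite size_take_min -card_lifted -widthE geq_minl.
Qed.

Lemma full_cost_bound K : (0 < #|N|)%N ->
  (#|N| + K * r1 * (matroid_rank I * 2 ^ L + #|N| * L * (search_depth.+1 + 2 * 2 ^ L) + 2))%:R <=
  (1 + K%:R * (1 * 2 ^+ L + L%:R * ((2 + 2 * ln L%:R) + 2 * 2 ^+ L) + 2)) *
  polylog R 1 #|N| * (#|N|%:R * r1%:R).
Proof.
move=> n0; have r_n : (r1 <= #|N|)%N by rewrite geq_max rank_le_card.
have r10 : (0 < r1)%N by rewrite leq_max orbT.
rewrite /polylog expr1 !(natrD, natrM, natrX).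
apply: query_bound; rewrite ?mulr_ge0 ?exprn_ge0 //.
- by rewrite lerDl ln_ge0 // ler1n.
- by rewrite -natrM ler_nat leq_pmulr.
- by rewrite -natrM ler_nat leq_pmull.
- by rewrite mul1r -!natrM ler_nat mulnC leq_mul2r rank_le_card orbT.
- by rewrite -!natrM ler_nat mulnC [X in (X * _ <= _)%N]mulnC -mulnA.
- exact: search_depth_le.
Qed.

Lemma sampled_cost_bound K : (0 < #|N|)%N ->
  (#|N| + K * r1 * (sample_width * 2 ^ L +
    (#|N| * L %/ (2 * sample_width)).+1 * (search_depth.+1 + 2 * 2 ^ L) + 2))%:R <=
  (1 + K%:R * (2 * 2 ^+ L + (L%:R + 1) * ((2 + 2 * ln L%:R) + 2 * 2 ^+ L) + 2)) *
  polylog R 1 #|N| * (#|N|%:R + (matroid_rank I)%:R * Num.sqrt #|N|%:R).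
Proof.
move=> n0; set b := sample_width; set r := matroid_rank I; set n := #|N|.
set Q := n%:R + _; set d := (_ %/ _)%N.
pose s : R := Num.sqrt n%:R.
have s2 : s * s = n%:R by rewrite -expr2 sqr_sqrtr.
have s1 : 1 <= s by rewrite -sqrtr1 ler_sqrt // ler1n.
have [s_lt s_ge] : s < sqrt_width%:R /\ sqrt_width%:R <= s + 1 :> R.
  have /andP[le_s lt_s] := truncn_itv (le_trans ler01 s1).
  by rewrite /sqrt_width -/n -/s; split=> //; rewrite -natr1 lerD2r.
have r_s : r1%:R * s <= Q.
  apply: le_trans (_ : (r%:R + 1) * s <= _).
    rewrite ler_wpM2r ?(le_trans ler01) // natr1 ler_nat.
    by rewrite geq_max leqnSn.
  rewrite mulrDl mul1r /Q addrC lerD2r -s2 ler_peMr //; exact: le_trans s1.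
have s0 : 0 <= s := le_trans ler01 s1.
have r_Q : r1%:R <= Q by apply: le_trans r_s; rewrite ler_peMr.
have n_Q : n%:R <= Q by rewrite lerDl mulr_ge0.
have Q0 : 0 <= Q by apply: le_trans n_Q.
have d_b : (d * b <= n * L)%N.
  rewrite /d; apply: leq_trans (leq_trunc_div (n * L) (2 * b)).
  by rewrite leq_mul2l mul2n -addnn leq_addr orbT.
have r_d : r1%:R * d%:R <= L%:R * Q.
  move: d_b; rewrite /b /sample_width; case: (leqP r1 sqrt_width) => _ d_b.
    apply: le_trans (_ : L%:R * n%:R <= _); last by rewrite ler_wpM2l.
    by rewrite -!natrM ler_nat mulnC [leqRHS]mulnC.
  apply: le_trans (_ : L%:R * (r1%:R * s) <= _); last by rewrite ler_wpM2l.
  rewrite mulrCA ler_wpM2l //.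
  have s_gt0 : 0 < s by apply: lt_le_trans s1.
  rewrite -(ler_pM2r s_gt0) -mulrA s2.
  apply: le_trans (_ : d%:R * sqrt_width%:R <= _); first by rewrite ler_wpM2l // ltW.
  by rewrite -!natrM ler_nat [leqRHS]mulnC.
rewrite /polylog expr1 -[d.+1]addn1 !(natrD, natrM, natrX).
apply: query_bound; rewrite ?mulr_ge0 ?exprn_ge0 //.
- by rewrite addr_ge0.
- by rewrite lerDl ln_ge0 // ler1n.
- apply: le_trans (_ : r1%:R * (s + 1) <= _).
    by rewrite ler_wpM2l // (le_trans _ s_ge) // ler_nat geq_minr.
  by rewrite mulrDr mulr1 mulrDl mul1r lerD.
- by rewrite mulrDr mulr1 mulrDl mul1r lerD.
- by have := search_depth_le n0; rewrite -addn1 natrD.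
Qed.

Lemma full_step_guarantee K m : (0 < K)%N -> (K * r1 <= m)%N ->
  (1 - growth R l ^- L - 8 * total_weight R l / K%:R) * opt f I <=
  f (run (solve full_step K (nseq m tt))).
Proof.
move=> K0 Km.
have unit0 : (0 < #|{: unit}|)%N by rewrite card_unit.
have avg_unit (F : unit -> R) : avg F = F tt.
  by rewrite /avg card_unit divr1 (bigD1 tt) //= big1 ?addr0 // => -[].
have avgs_unit k (F : seq unit -> R) : avgs k F = F (nseq k tt).
  by elim: k F => //= k IH F; rewrite avg_unit IH.
rewrite -(avgs_unit m (fun ws => f (run (solve full_step K ws)))).
apply: solve_guarantee => //; first exact: full_step_base.
move=> S V baseS VM; rewrite avg_unit.
apply: le_trans (full_gain matM mong subg (run_query_potential f I) (run_query_lift f I)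
  search_depth_ge baseS VM) _.
have XS : {subset enum S <= S} by move=> x; rewrite mem_enum.
have [_ gS _] := step_spec matM mong subg (run_query_potential f I) (run_query_lift f I)
  search_depth_ge (enum {: E}) baseS (enum_uniq _) XS.
rewrite ler_wpM2r ?subr_ge0 //; have : 0 <= (rank1 S)%:R :> R by [].
lra.
Qed.

Lemma sample_seed_gt0 : (0 < #|N|)%N -> (0 < #|{: sample_seed E}|)%N.
Proof.
move=> n0; rewrite card_prod card_ord card_tuple muln_gt0 fact_gt0 expn_gt0.
by rewrite card_lifted muln_gt0 n0.
Qed.

Lemma sampled_step_guarantee K m : (0 < #|N|)%N -> (0 < K)%N -> (K * r1 <= m)%N ->
  (1 - growth R l ^- L - 8 * total_weight R l / K%:R) * opt f I <=
  avgs m (fun ws => f (run (solve sampled_step K ws))).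
Proof.
move=> n0 K0 Km; apply: solve_guarantee => //.
- exact: sample_seed_gt0.
- exact: sampled_step_base.
have E0 : (0 < #|{: E}|)%N by rewrite card_lifted muln_gt0 n0.
move=> S V baseS VM.
exact: (sample_gain matM mong subg (run_query_potential f I) (run_query_lift f I)
  search_depth_ge (ltn0Sn _) E0 baseS VM).
Qed.

End Algorithms.

Section MainAlgorithms.
Variable R : realType.

Definition colors (eps : R) : nat := Num.bound (2 / eps).

Definition rounds (eps : R) : nat :=
  (Num.bound (16 * total_weight R (colors eps) / eps)).+1.

Lemma colors_rounds_ok eps : 0 < eps ->
  1 - (expR 1)^-1 - eps <=
  1 - growth R (colors eps) ^- (colors eps).+1 -
    8 * total_weight R (colors eps) / (rounds eps)%:R.
Proof.
move=> eps0; have := growth_inv_le R (colors eps).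
have : (colors eps).+1%:R^-1 <= eps / 2.
  rewrite -[eps / 2]invf_div lef_pV2 ?posrE ?divr_gt0 //.
  apply/ltW/(lt_le_trans (archi_boundP _) _); last by rewrite ler_nat.
  by rewrite divr_ge0 // ltW.
have w0 : 0 <= total_weight R (colors eps) by apply: sumr_ge0 => J _; apply: weight_ge0.
have : 8 * total_weight R (colors eps) / (rounds eps)%:R <= eps / 2.
  rewrite ler_pdivrMr ?ltr0n //.
  have : 16 * total_weight R (colors eps) / eps < (rounds eps)%:R.
    apply: lt_le_trans (archi_boundP _) _; last by rewrite ler_nat.
    by rewrite divr_ge0 ?mulr_ge0 // ltW.
  rewrite ltr_pdivrMr //; lra.
move: (8 * _ / _) (_ ^- _) ((colors eps).+1%:R^-1) ((expR 1)^-1) => a b c d; lra.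
Qed.

Definition deterministic_alg (N : finType) (eps : R) : query_alg R N :=
  if #|N| == 0%N then Output R set0 else
  compile (solve (@full_step R N (colors eps)) (rounds eps) (nseq (rounds eps * #|N|) tt)).

Lemma seeds_gt0 (N : finType) (v : N) l m : (0 < #|{: m.-tuple (sample_seed (N * 'I_l.+1))}|)%N.
Proof.
by rewrite card_tuple expn_gt0 sample_seed_gt0 //; apply/card_gt0P; exists v.
Qed.

Lemma unit_gt0 : (0 < #|{: unit}|)%N.
Proof. by rewrite card_unit. Qed.

Definition randomized_alg (N : finType) (eps : R) : rand_query_alg R N :=
  if [pick v : N] is Some v then
    uniform_alg (seeds_gt0 v (colors eps) (rounds eps * #|N|))
      (fun ws => compile (solve (@sampled_step R N (colors eps)) (rounds eps) ws))
  else uniform_alg unit_gt0 (fun _ => Output R set0).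

Lemma trivial_guarantee (N : finType) (f : {set N} -> R) I eps : instance f I -> 0 < eps ->
  #|N| = 0%N -> set0 \in I /\ (1 - (expR 1)^-1 - eps) * opt f I <= f set0.
Proof.
move=> instfI eps0 n0; have [f0 _ _ matI] := instfI.
split; first exact: indep0.
have [T TI [-> maxT]] := opt_attained instfI.
have -> : T = set0.
  by apply/setP => v; have := card0_eq n0 v; rewrite inE.
have : 0 <= (expR 1)^-1 :> R by rewrite invr_ge0 expR_ge0.
have := f0 set0 => fs e0; rewrite ler_piMl //; lra.
Qed.

End MainAlgorithms.

Theorem theorem1p2 (R : realType) :
  (exists (A : forall N : finType, R -> query_alg R N) (k : nat),
    forall eps : R, 0 < eps -> exists C : R,
      forall (N : finType) (f : {set N} -> R) (I : {set {set N}}),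
        instance f I ->
        let n := #|N| in
        let r := matroid_rank I in
        let S := output f I (A N eps) in
        [/\ S \in I,
            (1 - (expR 1)^-1 - eps) * opt f I <= f S
          & (queries f I (A N eps))%:R
              <= C * polylog R k n * (n%:R * (maxn r 1)%:R)])
  /\
  (exists (A : forall N : finType, R -> rand_query_alg R N) (k : nat),
    forall eps : R, 0 < eps -> exists C : R,
      forall (N : finType) (f : {set N} -> R) (I : {set {set N}}),
        instance f I ->
        let n := #|N| in
        let r := matroid_rank I in
        [/\ forall w : seed (A N eps), output f I (A N eps w) \in I,
            (1 - (expR 1)^-1 - eps) * opt f I <= expected_value f I (A N eps)
          & forall w : seed (A N eps),
              (queries f I (A N eps w))%:R
                <= C * polylog R k n * (n%:R + r%:R * Num.sqrt n%:R)]).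
Proof.
split.
  exists (@deterministic_alg R), 1%N => eps eps0.
  exists (1 + (rounds eps)%:R * (1 * 2 ^+ (colors eps).+1 + (colors eps).+1%:R *
    ((2 + 2 * ln (colors eps).+1%:R) + 2 * 2 ^+ (colors eps).+1) + 2)) => N f I instfI /=.
  rewrite /deterministic_alg; case: posnP => [n0|n0].
    have [S0I S0f] := trivial_guarantee instfI eps0 n0.
    by split=> //=; rewrite n0 mul0r mulr0.
  have Km : (rounds eps * maxn (matroid_rank I) 1 <= rounds eps * #|N|)%N.
    by rewrite leq_mul2l geq_max rank_le_card n0 orbT.
  rewrite output_compile queries_compile; split.
  - exact: (solve_indep instfI (full_step_base instfI)).
  - apply: le_trans (full_step_guarantee (colors eps) instfI (isT : (0 < rounds eps)%N) Km).
    rewrite ler_wpM2r ?colors_rounds_ok //.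
    by have [T TI [-> _]] := opt_attained instfI; case: instfI.
  - apply: le_trans (full_cost_bound R (colors eps) I (rounds eps) n0).
    by rewrite ler_nat; apply: (cost_solve instfI (full_step_base instfI)); apply: cost_full_step.
exists (@randomized_alg R), 1%N => eps eps0.
exists (1 + (rounds eps)%:R * (2 * 2 ^+ (colors eps).+1 + ((colors eps).+1%:R + 1) *
  ((2 + 2 * ln (colors eps).+1%:R) + 2 * 2 ^+ (colors eps).+1) + 2)) => N f I instfI /=.
rewrite /randomized_alg; case: pickP => [v _|noN].
  have n0 : (0 < #|N|)%N by apply/card_gt0P; exists v.
  have Km : (rounds eps * maxn (matroid_rank I) 1 <= rounds eps * #|N|)%N.
    by rewrite leq_mul2l geq_max rank_le_card n0 orbT.
  split.
  - by move=> w; rewrite /= output_compile; apply: (solve_indep instfI (sampled_step_base instfI)).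
  - rewrite expected_uniform.
    under eq_avg do rewrite output_compile.
    rewrite (avg_tuple _ (fun ws => f (run f I (solve _ _ ws)))).
    apply: le_trans (sampled_step_guarantee (colors eps) instfI n0 (isT : (0 < rounds eps)%N) Km).
    rewrite ler_wpM2r ?colors_rounds_ok //.
    by have [T TI [-> _]] := opt_attained instfI; case: instfI.
  - move=> w; apply: le_trans (sampled_cost_bound R (colors eps) I (rounds eps) n0).
    rewrite ler_nat /= queries_compile.
    by apply: (cost_solve instfI (sampled_step_base instfI)); apply: cost_sampled_step.
have n0 : #|N| = 0%N by apply: eq_card0 => v; have := noN v.
have [S0I S0f] := trivial_guarantee instfI eps0 n0.
split=> //=; first by rewrite expected_uniform avg_const // unit_gt0.
by move=> _; rewrite n0 sqrtr0 mulr0 addr0 mulr0.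
Qed.
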